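(* Let $\sigma,\tau\in\mathbb{R}$ satisfy $\tau<0$ and $\tau-\sigma>1/2$. Then the infinite matrix $$E=\left\{\frac{n^\sigma m^\sigma}{[n,m]^\tau}\right\}_{n,m=1}^\infty$$ defines a bounded, compact and self-adjoint operator on $\ell^2(\mathbb{N})$ with trivial kernel. Moreover, $E$ has infinitely many negative eigenvalues and infinitely many positive eigenvalues.
   Context: $\mathbb{N}=\{1,2,3,\dots\}$, and $[n,m]$ denotes the least common multiple of the natural numbers $n$ and $m$. The matrix $E$ is regarded as an operator on the Hilbert space $\ell^2(\mathbb{N})$ acting by matrix multiplication with respect to the standard basis. *)

(* Defs.v *)
From HB Require Import structures.
From mathcomp Require Import all_boot all_order all_algebra.
From mathcomp Require Import all_classical all_reals all_analysis.
From mathcomp Require Import complex ring.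
Set Implicit Arguments.
Unset Strict Implicit.
Unset Printing Implicit Defensive.
Import Order.TTheory GRing.Theory Num.Theory.
Import numFieldNormedType.Exports.
Import Normc.
Local Open Scope classical_set_scope.
Local Open Scope complex_scope.
Local Open Scope ring_scope.

(* The library equips R[i] with a modulus but not with the induced topology. *)
HB.instance Definition _ (R : realType) := NormedModule.copy R[i] R[i]^o.

(* Sequences are indexed by nat = {0, 1, ...}; the term of index n stands for
   the (n+1)-st coordinate of an element of l^2({1, 2, ...}). *)
Definition sqmod (R : realType) (x : nat -> R[i]) : nat -> R :=
  fun n => normc (x n) ^+ 2.

Definition square_summable (R : realType) : {pred nat -> R[i]} :=
  fun x => `[< cvgn (series (sqmod x)) >].

Lemma normc_ge0 (R : realType) (z : R[i]) : 0 <= normc z.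
Proof. by case: z => a b /=; exact: sqrtr_ge0. Qed.

Lemma sqmod_ge0 (R : realType) (x : nat -> R[i]) n : 0 <= sqmod x n.
Proof. exact: sqr_ge0. Qed.

Lemma series_sqmod_nd (R : realType) (x : nat -> R[i]) :
  nondecreasing_seq (series (sqmod x)).
Proof. by apply: nondecreasing_series => n _ _; exact: sqmod_ge0. Qed.

Lemma series_sqmod_ge0 (R : realType) (x : nat -> R[i]) n :
  0 <= series (sqmod x) n.
Proof. by apply: sumr_ge0 => k _; exact: sqmod_ge0. Qed.

Lemma bounded_sqmod (R : realType) (x : nat -> R[i]) (M : R) :
  (forall n, series (sqmod x) n <= M) ->
  cvgn (series (sqmod x)) /\ limn (series (sqmod x)) <= M.
Proof.
move=> xM.
have cx : cvgn (series (sqmod x)).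
  apply: nondecreasing_is_cvgn; first exact: series_sqmod_nd.
  by exists M => _ [n _ <-].
by split=> //; apply: limr_le => //; near=> n.
Unshelve. all: by end_near. Qed.

Lemma sqmod_le_lim (R : realType) (x : nat -> R[i]) :
  cvgn (series (sqmod x)) -> forall n, sqmod x n <= limn (series (sqmod x)).
Proof.
move=> cx n; apply: le_trans (nondecreasing_cvgn_le (@series_sqmod_nd _ x) cx n.+1).
by rewrite seriesSr lerDr series_sqmod_ge0.
Qed.

Lemma lim_sqmod_ge0 (R : realType) (x : nat -> R[i]) :
  cvgn (series (sqmod x)) -> 0 <= limn (series (sqmod x)).
Proof. by move=> cx; exact: le_trans (sqmod_ge0 x 0) (sqmod_le_lim cx 0). Qed.

Lemma sqmod0 (R : realType) : sqmod (0 : nat -> R[i]) = 0.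
Proof. by apply/funext => n; rewrite /sqmod [normc _]normc0 expr0n. Qed.

Lemma sqmodZ (R : realType) (a : R[i]) (x : nat -> R[i]) :
  sqmod (a *: x) = normc a ^+ 2 *: sqmod x.
Proof. by apply/funext => n; rewrite /sqmod [normc _]normcM exprMn. Qed.

Lemma lim_sqmod_eq0 (R : realType) (x : nat -> R[i]) :
  cvgn (series (sqmod x)) -> limn (series (sqmod x)) = 0 -> x = 0.
Proof.
move=> cx x0; apply/funext => n; apply: eq0_normc; apply/eqP.
rewrite -sqrf_eq0 eq_le sqr_ge0 andbT -[X in _ <= X]x0.
exact: sqmod_le_lim.
Qed.

Lemma lim_sqmodZ (R : realType) (a : R[i]) (x : nat -> R[i]) :
  cvgn (series (sqmod x)) ->
  cvgn (series (sqmod (a *: x))) /\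
  limn (series (sqmod (a *: x))) = normc a ^+ 2 * limn (series (sqmod x)).
Proof.
by move=> cx; rewrite sqmodZ; split; [exact: is_cvg_seriesZ|rewrite lim_seriesZ].
Qed.

Lemma sqmod_minkowski (R : realType) (x y : nat -> R[i]) :
  cvgn (series (sqmod x)) -> cvgn (series (sqmod y)) ->
  cvgn (series (sqmod (x + y))) /\
  Num.sqrt (limn (series (sqmod (x + y)))) <=
    Num.sqrt (limn (series (sqmod x))) + Num.sqrt (limn (series (sqmod y))).
Proof.
move=> cx cy; set s := Num.sqrt (limn (series (sqmod x))).
set t := Num.sqrt (limn (series (sqmod y))).
have s0 : 0 <= s by exact: sqrtr_ge0.
have t0 : 0 <= t by exact: sqrtr_ge0.
have sE : limn (series (sqmod x)) = s ^+ 2 by rewrite sqr_sqrtr// lim_sqmod_ge0.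
have tE : limn (series (sqmod y)) = t ^+ 2 by rewrite sqr_sqrtr// lim_sqmod_ge0.
have [s_eq0|s_neq0] := eqVneq s 0.
  have -> : x = 0 by apply: lim_sqmod_eq0; rewrite // sE s_eq0 expr0n.
  by rewrite add0r -/t lerDr.
have [t_eq0|t_neq0] := eqVneq t 0.
  have -> : y = 0 by apply: lim_sqmod_eq0; rewrite // tE t_eq0 expr0n.
  by rewrite addr0 -/s lerDl.
have sp : 0 < s by rewrite lt_neqAle eq_sym s_neq0.
have tp : 0 < t by rewrite lt_neqAle eq_sym t_neq0.
have key n : series (sqmod (x + y)) n <= (s + t) ^+ 2.
  have xn := nondecreasing_cvgn_le (@series_sqmod_nd _ x) cx n.
  have yn := nondecreasing_cvgn_le (@series_sqmod_nd _ y) cy n.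
  rewrite sE in xn; rewrite tE in yn.
  have uv (u v : R) : (u + v) ^+ 2 <= (s + t) * (u ^+ 2 / s + v ^+ 2 / t).
    rewrite -subr_ge0.
    suff -> : (s + t) * (u ^+ 2 / s + v ^+ 2 / t) - (u + v) ^+ 2 =
              (t * u - s * v) ^+ 2 / (s * t).
      by rewrite divr_ge0 ?sqr_ge0// mulr_ge0.
    by field; rewrite ?s_neq0 ?t_neq0.
  apply: (@le_trans _ _
    ((s + t) * (series (sqmod x) n / s + series (sqmod y) n / t))).
    rewrite /series/= !mulr_suml -big_split/= mulr_sumr.
    apply: ler_sum => k _; apply: le_trans (uv _ _).
    rewrite /sqmod ler_pXn2r ?nnegrE ?normc_ge0 ?addr_ge0 ?normc_ge0//.
    exact: le_normcD.
  rewrite expr2 ler_pM2l ?addr_gt0//.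
  by apply: lerD; rewrite ler_pdivrMr// -expr2.
have [cxy lxy] := bounded_sqmod key; split=> //.
by rewrite -[leRHS]ger0_norm ?addr_ge0// -sqrtr_sqr ler_wsqrtr.
Qed.

Lemma square_summable_submod_closed (R : realType) :
  submod_closed (@square_summable R).
Proof.
split.
  rewrite unfold_in; apply/asboolP; rewrite sqmod0.
  apply: (@cvgP _ _ 0); rewrite (_ : series 0 = cst 0); first exact: cvg_cst.
  by apply/funext => n; rewrite /series/= big1.
move=> a x y /asboolP cx /asboolP cy; apply/asboolP.
by have [] := sqmod_minkowski (lim_sqmodZ a cx).1 cy.
Qed.

HB.instance Definition _ (R : realType) :=
  GRing.isSubmodClosed.Build _ _ (@square_summable R)
    (@square_summable_submod_closed R).

Record ell2 (R : realType) := Ell2 {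
  ell2_seq :> nat -> R[i];
  ell2P : ell2_seq \in @square_summable R }.

HB.instance Definition _ (R : realType) := [isSub for @ell2_seq R].
HB.instance Definition _ (R : realType) := [Choice of ell2 R by <:].
HB.instance Definition _ (R : realType) :=
  [SubChoice_isSubLmodule of ell2 R by <:].

(* The norm takes values in the scalar field, as normedModType R[i] requires. *)
Definition ell2_norm (R : realType) (x : ell2 R) : R[i] :=
  (Num.sqrt (limn (series (sqmod x))))%:C.

Lemma ell2_cvg (R : realType) (x : ell2 R) : cvgn (series (sqmod x)).
Proof. exact/asboolP/(ell2P x). Qed.

Lemma ell2_normD (R : realType) (x y : ell2 R) :
  ell2_norm (x + y) <= ell2_norm x + ell2_norm y.
Proof.
rewrite -rmorphD lecR.
by have [] := sqmod_minkowski (@ell2_cvg _ x) (@ell2_cvg _ y).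
Qed.

Lemma ell2_normZ (R : realType) (a : R[i]) (x : ell2 R) :
  ell2_norm (a *: x) = `|a| * ell2_norm x.
Proof.
rewrite /ell2_norm (lim_sqmodZ a (@ell2_cvg _ x)).2.
rewrite sqrtrM ?sqr_ge0// sqrtr_sqr ger0_norm ?normc_ge0// rmorphM.
by congr (_ * _).
Qed.

Lemma ell2_norm_eq0 (R : realType) (x : ell2 R) : ell2_norm x = 0 -> x = 0.
Proof.
move=> /(@complexI R) /eqP; rewrite sqrtr_eq0 => x0; apply: val_inj.
apply: lim_sqmod_eq0; first exact: ell2_cvg.
by apply/eqP; rewrite eq_le x0 lim_sqmod_ge0//; exact: ell2_cvg.
Qed.

HB.instance Definition _ (R : realType) :=
  Lmodule_isNormed.Build R[i] (ell2 R)
    (@ell2_normD R) (@ell2_normZ R) (@ell2_norm_eq0 R).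

Definition ell2_inner (R : realType) (x y : ell2 R) : R[i] :=
  limn (series (fun n => x n * (y n)^*)).

Lemma cvg_real_complex (R : realType) (u : nat -> R) (l : R) : 
  u @ \oo --> l -> (fun n => (u n)%:C) @ \oo --> l%:C.
Proof.
move=> /cvgrPdist_lt ul; apply/cvgrPdist_lt => e e0.
have eE : e = (complex.Re e)%:C by rewrite RRe_real// gtr0_real.
have r0 : 0 < complex.Re e by rewrite -ltcR -eE.
have := ul _ r0; apply: filterS => n; rewrite -rmorphB eE => h.
rewrite normc_def /= expr0n addr0 sqrtr_sqr ltcR//.
Qed.
Lemma ell2_innerxx (R : realType) (x : ell2 R) : ell2_inner x x = `|x| ^+ 2.
Proof.
apply: cvg_lim; first exact: norm_hausdorff.
rewrite -[`|x|]/(ell2_norm x) /ell2_norm -rmorphXn.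
rewrite sqr_sqrtr ?lim_sqmod_ge0//; last exact: ell2_cvg.
rewrite (_ : series _ = fun n => (series (sqmod x) n)%:C).
  by apply: cvg_real_complex; exact: ell2_cvg.
apply/funext => n; rewrite /series/= rmorph_sum; apply: eq_bigr => k _.
by rewrite -normCK [RHS]rmorphXn; congr (_ ^+ _).
Qed.

(* T acts as multiplication by the infinite matrix A: for every x in l^2 and
   every n, the series \sum_m A n m * x m converges, with sum (T x) n. *)
Definition matrix_operator (R : realType) (A : nat -> nat -> R[i])
    (T : ell2 R -> ell2 R) : Prop :=
  forall (x : ell2 R) (n : nat),
    series (fun m => A n m * x m) @ \oo --> T x n.

Definition bounded_operator (R : realType) (T : ell2 R -> ell2 R) : Prop :=
  exists M : R, forall x : ell2 R, `|T x| <= M%:C * `|x|.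

Definition compact_operator (R : realType) (T : ell2 R -> ell2 R) : Prop :=
  forall B : set (ell2 R), bounded_set B -> precompact (T @` B).

(* S = T^* for everywhere defined operators, so that no domain is involved. *)
Definition is_adjoint (R : realType) (T S : ell2 R -> ell2 R) : Prop :=
  forall x y : ell2 R, ell2_inner (T x) y = ell2_inner x (S y).

Definition self_adjoint (R : realType) (T : ell2 R -> ell2 R) : Prop :=
  is_adjoint T T.

Definition eigenvalue_of (R : realType) (T : ell2 R -> ell2 R) (l : R[i]) :
    Prop :=
  exists2 x : ell2 R, x != 0 & T x = l *: x.

Definition lcm_kernel (R : realType) (sigma tau : R) (n m : nat) : R :=
  n%:R `^ sigma * m%:R `^ sigma / (lcmn n m)%:R `^ tau.

(* Row and column indices are shifted by one, as for ell2. *)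
Definition lcm_matrix (R : realType) (sigma tau : R) : nat -> nat -> R[i] :=
  fun n m => (lcm_kernel sigma tau n.+1 m.+1)%:C.

(* Main.v *)
Require Import Defs.
From HB Require Import structures.
From mathcomp Require Import all_boot all_order all_algebra.
From mathcomp Require Import all_classical all_reals all_analysis.
From mathcomp Require Import complex.
From mathcomp Require Import ring lra.
Import Order.TTheory GRing.Theory Num.Theory.
Import numFieldNormedType.Exports.
Import Normc.
Set Implicit Arguments.
Unset Strict Implicit.
Unset Printing Implicit Defensive.
Local Open Scope classical_set_scope.
Local Open Scope complex_scope.
Local Open Scope ring_scope.

(** With [a = tau - sigma > 1/2] the identity [lcm(n, m) gcd(n, m) = n m] turns
the matrix into [n^-a m^-a gcd(n, m)^tau] ([lcm_kernelE]). Since [tau < 0], the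
last factor is at most [1], so that the entries are dominated by [n^-a m^-a]
with [n^-a] square summable: the matrix is Hilbert-Schmidt. For such a matrix
the operator is constructed in [hs_op], and it is bounded, compact (it maps
balls into a Hilbert cube, [hs_op_compact]) and self-adjoint when the matrix is
Hermitian ([hs_op_self_adjoint]).

Trivial kernel. If [E x = 0], then [y m = m^-a x m] is absolutely summable and
[sum_m gcd(n, m)^tau y m = 0] for all [n]. Taking differences between
[n p^(k+1)] and [n p^k] for one prime [p] after the other isolates the sums of
[y] over the multiples of an arbitrary [d] ([annihilates_dvd_gcd]); the factors
that appear are differences of consecutive values of [p^(k tau)], which are
nonzero as [tau < 0]. So all these sums vanish, and a sieve then shows that [y = 0]
([annihilates_dvd_eq0]).

Signs of the eigenvalues. A compact self-adjoint operator whose quadratic form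
is positive definite on subspaces of arbitrarily large dimension has
arbitrarily many orthonormal eigenvectors with positive eigenvalues
([positive_eigenvectors], by repeated maximization of the form,
[spectral_step]). Their squared eigenvalues have a sum bounded by the squared
Hilbert-Schmidt norm, so that they cannot take finitely many values only
([hs_op_infinite_positive]); negative eigenvalues are obtained from [- E].
The form of [E], after the weights are removed, is
[sum gcd(n, m)^tau y n (y m)^*]. For the vectors [e_(2^(i+1)) - e_(2^i)] it is
diagonal with entries [2^((i+1) tau) - 2^(i tau) < 0], and for their
tensor products with [e_3 - e_1], that is
[e_(3 2^(i+1)) - e_(3 2^i) - e_(2^(i+1)) + e_(2^i)], the entries are multiplied
by [3^tau - 1 < 0] and become positive ([dyadic_gram]). *)

(** * Inner product of l^2 *)

Lemma normc_normr (R : realType) (z : R[i]) : `|z| = (normc z)%:C.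
Proof. by []. Qed.

Lemma normc_conj (R : realType) (z : R[i]) : normc z^* = normc z.
Proof. by apply: (@complexI R); rewrite -!normc_normr norm_conjC. Qed.

(** Reduction to the real comparison test, since [normc z] dominates both the real
and the imaginary part of [z]. *)
Lemma complex_series_cvg (R : realType) (u : nat -> R[i]) (h : nat -> R) :
  (forall n, normc (u n) <= h n) -> cvgn (series h) -> cvgn (series u).
Proof.
move=> uh ch.
have h0 n : 0 <= h n by apply: le_trans (uh n); exact: normc_ge0.
have real_part (v : nat -> R) : (forall n, `|v n| <= normc (u n)) ->
    cvgn (series v).
  move=> vu; apply: normed_cvg; apply: (@series_le_cvg R _ h) => //= n.
  exact: le_trans (vu n) (uh n).
have cRe : cvgn (series (fun n => complex.Re (u n))).
  by apply: real_part => n; rewrite -lecR -normc_normr normc_ge_Re.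
have cIm : cvgn (series (fun n => complex.Im (u n))).
  apply: real_part => n.
  rewrite -lecR -normc_normr -[X in _ <= X]mul1r.
  have <- : `|- 'i%C| = 1 :> R[i].
    by rewrite normrN normc_def/= expr0n expr1n add0r sqrtr1.
  rewrite -normrM mulrC.
  apply: le_trans (normc_ge_Re _).
  by rewrite mulrN raddfN/= ReiNIm opprK.
apply/cvg_ex; eexists.
rewrite (_ : series u = (fun n => (series (fun k => complex.Re (u k)) n)%:C +
   'i%C * (series (fun k => complex.Im (u k)) n)%:C)).
  apply: cvgD; first by apply: cvg_real_complex; exact: cRe.
  by apply: cvgMr; apply: cvg_real_complex; exact: cIm.
apply/funext => n; rewrite /series/= !rmorph_sum mulr_sumr -big_split/=.
by apply: eq_bigr => k _; rewrite -complexE.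
Qed.

Lemma ell2_inner_cvg (R : realType) (x y : ell2 R) :
  cvgn (series (fun n => x n * (y n)^*)).
Proof.
apply: (@complex_series_cvg _ _ (sqmod x + sqmod y)) => [n|]; last first.
  by apply: is_cvg_seriesD; exact: ell2_cvg.
rewrite normcM normc_conj /sqmod fctE.
have := sqr_ge0 (normc (x n) - normc (y n)).
have := normc_ge0 (x n); have := normc_ge0 (y n); nra.
Qed.

Lemma ell2_inner_lim (R : realType) (x y : ell2 R) :
  series (fun n => x n * (y n)^*) @ \oo --> ell2_inner x y.
Proof. exact: ell2_inner_cvg. Qed.

Lemma ell2_ext (R : realType) (x y : ell2 R) : (forall n, x n = y n) -> x = y.
Proof. by move=> xy; apply: val_inj; apply/funext. Qed.

Lemma ell2_coordD (R : realType) (x y : ell2 R) n : (x + y) n = x n + y n.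
Proof. by []. Qed.

Lemma ell2_coordZ (R : realType) (a : R[i]) (x : ell2 R) n : (a *: x) n = a * x n.
Proof. by []. Qed.

Lemma ell2_innerP (R : realType) (a : R[i]) (x y z : ell2 R) :
  ell2_inner (a *: x + y) z = a * ell2_inner x z + ell2_inner y z.
Proof.
apply: cvg_lim; first exact: norm_hausdorff.
rewrite (_ : series _ = (fun n => a * series (fun n => x n * (z n)^*) n +
                       series (fun n => y n * (z n)^*) n)).
  by apply: cvgD; [apply: cvgMr|]; exact: ell2_inner_lim.
apply/funext => n; rewrite /series/= mulr_sumr -big_split/=.
by apply: eq_bigr => k _; rewrite mulrDl mulrA.
Qed.

Lemma ell2_innerC (R : realType) (x y : ell2 R) :
  ell2_inner y x = (ell2_inner x y)^*.
Proof.
apply: cvg_lim; first exact: norm_hausdorff.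
have /cvgrPdist_lt xy := @ell2_inner_lim _ x y.
apply/cvgrPdist_lt => e /xy; apply: filterS => n.
rewrite -norm_conjC rmorphB/=.
suff -> : (series (fun k => x k * (y k)^*) n)^* =
  series (fun k => y k * (x k)^*) n.
  by [].
rewrite /series/= rmorph_sum; apply: eq_bigr => k _.
by rewrite rmorphM/= conjCK mulrC.
Qed.

Lemma ell2_innerDl (R : realType) (x y z : ell2 R) :
  ell2_inner (x + y) z = ell2_inner x z + ell2_inner y z.
Proof. by have := ell2_innerP 1 x y z; rewrite scale1r mul1r. Qed.

Lemma ell2_inner0l (R : realType) (z : ell2 R) : ell2_inner 0 z = 0.
Proof.
have := ell2_innerDl 0 0 z; rewrite addr0 -{1}[ell2_inner 0 z]addr0.
by move/addrI => <-.
Qed.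

Lemma ell2_innerZl (R : realType) a (x z : ell2 R) :
  ell2_inner (a *: x) z = a * ell2_inner x z.
Proof. by have := ell2_innerP a x 0 z; rewrite !addr0 ell2_inner0l addr0. Qed.

Lemma ell2_innerNl (R : realType) (x z : ell2 R) :
  ell2_inner (- x) z = - ell2_inner x z.
Proof. by rewrite -scaleN1r ell2_innerZl mulN1r. Qed.

Lemma ell2_innerBl (R : realType) (x y z : ell2 R) :
  ell2_inner (x - y) z = ell2_inner x z - ell2_inner y z.
Proof. by rewrite ell2_innerDl ell2_innerNl. Qed.

Lemma ell2_inner_suml (R : realType) (I : finType) (f : I -> ell2 R) (z : ell2 R) :
  ell2_inner (\sum_i f i) z = \sum_i ell2_inner (f i) z.
Proof.
apply: (big_ind2 (fun u v => ell2_inner u z = v)) => //.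
  exact: ell2_inner0l.
by move=> x1 x2 y1 y2 <- <-; rewrite ell2_innerDl.
Qed.

Lemma ell2_innerDr (R : realType) (x y z : ell2 R) :
  ell2_inner z (x + y) = ell2_inner z x + ell2_inner z y.
Proof. by rewrite ell2_innerC ell2_innerDl rmorphD/= -!ell2_innerC. Qed.

Lemma ell2_innerZr (R : realType) a (x z : ell2 R) :
  ell2_inner z (a *: x) = a^* * ell2_inner z x.
Proof. by rewrite ell2_innerC ell2_innerZl rmorphM/= -!ell2_innerC. Qed.

Lemma ell2_innerNr (R : realType) (x z : ell2 R) :
  ell2_inner z (- x) = - ell2_inner z x.
Proof. by rewrite ell2_innerC ell2_innerNl rmorphN/= -!ell2_innerC. Qed.

Lemma ell2_inner0r (R : realType) (z : ell2 R) : ell2_inner z 0 = 0.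
Proof. by rewrite ell2_innerC ell2_inner0l rmorph0. Qed.

Lemma ell2_innerBr (R : realType) (x y z : ell2 R) :
  ell2_inner z (x - y) = ell2_inner z x - ell2_inner z y.
Proof. by rewrite ell2_innerDr ell2_innerNr. Qed.

Lemma ell2_inner_sumr (R : realType) (I : finType) (f : I -> ell2 R) (z : ell2 R) :
  ell2_inner z (\sum_i f i) = \sum_i ell2_inner z (f i).
Proof.
rewrite ell2_innerC ell2_inner_suml rmorph_sum/=; apply: eq_bigr => i _.
by rewrite -ell2_innerC.
Qed.

(** Expanding the square norm of [|y|^2 x - <x, y> y] gives
[|y|^2 (|x|^2 |y|^2 - |<x, y>|^2)]. *)
Lemma ell2_cauchy_schwarz (R : realType) (x y : ell2 R) :
  `|ell2_inner x y| <= `|x| * `|y|.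
Proof.
have [->|y0] := eqVneq y 0; first by rewrite ell2_inner0r normr0 mulr_ge0.
set c := ell2_inner x y.
have ny : 0 < `|y| by rewrite normr_gt0.
have : 0 <= `| (`|y| ^+ 2) *: x - c *: y| ^+ 2 by rewrite exprn_ge0.
rewrite -[X in _ <= X]ell2_innerxx ell2_innerBl !ell2_innerBr.
rewrite !ell2_innerZl !ell2_innerZr.
rewrite !ell2_innerxx (ell2_innerC x y) -/c rmorphXn/= (conj_Creal (normr_real y)).
set N := `|y| in ny *; set M := `|x|.
have -> : N ^+ 2 * (N ^+ 2 * M ^+ 2) - N ^+ 2 * (c^* * c) -
  (c * (N ^+ 2 * c^*) - c * (c^* * N ^+ 2)) =
  N ^+ 2 * ((M * N) ^+ 2 - c * c^*) by ring.
rewrite -normCK pmulr_rge0 ?exprn_gt0// subr_ge0.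
rewrite ler_pXn2r ?nnegrE ?mulr_ge0 ?normr_ge0//.
Qed.

(** * Norm and truncations *)

Lemma ell2_coordB (R : realType) (x y : ell2 R) n : (x - y) n = x n - y n.
Proof. by []. Qed.

(** The norm of [ell2 R] takes values in [R[i]]; suprema and limits of norms are
taken in [R]. *)
Definition rnorm (R : realType) (x : ell2 R) : R :=
  Num.sqrt (limn (series (sqmod x))).

Lemma ell2_normrE (R : realType) (x : ell2 R) : `|x| = (rnorm x)%:C.
Proof. by []. Qed.

Lemma rnorm_ge0 (R : realType) (x : ell2 R) : 0 <= rnorm x.
Proof. exact: sqrtr_ge0. Qed.

Lemma rnorm_sqr (R : realType) (x : ell2 R) :
  rnorm x ^+ 2 = limn (series (sqmod x)).
Proof. by rewrite sqr_sqrtr// lim_sqmod_ge0//; exact: ell2_cvg. Qed.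

Lemma rnormD (R : realType) (x y : ell2 R) : rnorm (x + y) <= rnorm x + rnorm y.
Proof. by rewrite -lecR rmorphD/= -!ell2_normrE ler_normD. Qed.

Lemma rnormZ (R : realType) (a : R[i]) (x : ell2 R) :
  rnorm (a *: x) = normc a * rnorm x.
Proof.
by apply: (@complexI R); rewrite rmorphM/= -!ell2_normrE -normc_normr normrZ.
Qed.

Lemma rnormN (R : realType) (x : ell2 R) : rnorm (- x) = rnorm x.
Proof. by apply: (@complexI R); rewrite -!ell2_normrE normrN. Qed.

Lemma rnorm_distC (R : realType) (x y : ell2 R) : rnorm (x - y) = rnorm (y - x).
Proof. by rewrite -rnormN opprB. Qed.

Lemma rnorm_triangle (R : realType) (z x y : ell2 R) :
  rnorm (x - y) <= rnorm (x - z) + rnorm (z - y).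
Proof. by rewrite -(subrKA z); exact: rnormD. Qed.

Lemma rnorm0 (R : realType) : rnorm (0 : ell2 R) = 0.
Proof. by apply: (@complexI R); rewrite -ell2_normrE normr0. Qed.

Lemma rnorm_eq0 (R : realType) (x : ell2 R) : (rnorm x == 0) = (x == 0).
Proof.
apply/eqP/eqP => [x0|->]; last exact: rnorm0.
by apply: ell2_norm_eq0; rewrite -[ell2_norm x]ell2_normrE ell2_normrE x0.
Qed.

Lemma normc_inner_le (R : realType) (x y : ell2 R) :
  normc (ell2_inner x y) <= rnorm x * rnorm y.
Proof. by rewrite -lecR rmorphM/= -normc_normr ell2_cauchy_schwarz. Qed.

Lemma rnorm_le (R : realType) (x : ell2 R) (M : R) : 0 <= M ->
  (forall n, series (sqmod x) n <= M ^+ 2) -> rnorm x <= M.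
Proof.
move=> M0 xM; have [_ h] := bounded_sqmod xM.
by rewrite -[leRHS]ger0_norm// -sqrtr_sqr ler_wsqrtr.
Qed.

Lemma square_summable_le (R : realType) (x : nat -> R[i]) (M : R) :
  (forall n, series (sqmod x) n <= M) -> x \in @square_summable R.
Proof. by move=> xM; apply/asboolP; have [] := bounded_sqmod xM. Qed.

Lemma series_sqmod_trunc_le (R : realType) N (f : nat -> R[i]) n :
  series (sqmod (fun k => if (k < N)%N then f k else 0)) n <=
    series (sqmod f) N.
Proof.
set g := fun _ => _.
have gf k : sqmod g k <= sqmod f k.
  by rewrite /sqmod /g; case: ifP => // _; rewrite normc0 expr0n sqr_ge0.
have [nN|/ltnW Nn] := leqP n N.
  apply: (@le_trans _ _ (series (sqmod f) n)); first exact: ler_sum.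
  exact: series_sqmod_nd.
have tail0 : \sum_(N <= k < n) sqmod g k = 0.
  rewrite big_nat_cond big1// => k /andP[/andP[Nk _] _].
  by rewrite /sqmod /g ltnNge Nk [normc _]normc0 expr0n.
by rewrite /series/= (big_cat_nat (leq0n N) Nn)/= tail0 addr0; exact: ler_sum.
Qed.

Definition trunc (R : realType) N (f : nat -> R[i]) : ell2 R :=
  Ell2 (square_summable_le (series_sqmod_trunc_le N f)).

Lemma truncE (R : realType) N (f : nat -> R[i]) n :
  trunc N f n = if (n < N)%N then f n else 0.
Proof. by []. Qed.

Lemma rnorm_trunc_sqr (R : realType) N (f : nat -> R[i]) :
  rnorm (trunc N f) ^+ 2 <= series (sqmod f) N.
Proof.
by rewrite rnorm_sqr; have [] := bounded_sqmod (series_sqmod_trunc_le N f).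
Qed.

Lemma truncB (R : realType) N (f g : nat -> R[i]) :
  trunc N f - trunc N g = trunc N (f - g).
Proof.
apply: ell2_ext => n; rewrite ell2_coordB !truncE.
by case: ifP => // _; rewrite subrr.
Qed.

Lemma is_cvg_series_scale (R : realType) (c : R) (b : nat -> R) :
  cvgn (series b) -> cvgn (series (fun n => c * b n)).
Proof.
by move=> cb; rewrite (_ : (fun n => _) = c *: b)//; exact: is_cvg_seriesZ.
Qed.

(** The tail of a dominating series bounds the truncation error for all the
dominated [x] at once; this uniformity is what makes the Hilbert cube compact. *)
Lemma rnorm_sub_trunc (R : realType) (x : ell2 R) (b : nat -> R) N :
  (forall n, sqmod x n <= b n) -> cvgn (series b) ->
  rnorm (x - trunc N x) ^+ 2 <= limn (series b) - series b N.
Proof.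
move=> xb cb; rewrite rnorm_sqr.
have b0 n : 0 <= b n by apply: le_trans (xb n); exact: sqmod_ge0.
have bnd : nondecreasing_seq (series b) by apply: nondecreasing_series => n _ _.
suff : forall n,
  series (sqmod (x - trunc N x)) n <= limn (series b) - series b N.
  by move=> /bounded_sqmod[].
move=> n; apply: (@le_trans _ _ (series b n - series b (minn n N))).
  elim: n => [|n IH]; first by rewrite min0n subrr /series/= big_nil.
  rewrite !seriesSr; have [nN|Nn] := ltnP n N.
    rewrite (minn_idPl nN) seriesSr subrr.
    move: IH; rewrite (minn_idPl (ltnW nN)) subrr => IH.
    suff -> : sqmod (x - trunc N x) n = 0 by rewrite addr0.
    by rewrite /sqmod ell2_coordB truncE nN subrr [normc _]normc0 expr0n.
  rewrite (minn_idPr (leqW Nn)); move: IH; rewrite (minn_idPr Nn) => IH.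
  rewrite addrAC lerD//; apply: le_trans (xb n).
  by rewrite /sqmod ell2_coordB truncE ltnNge Nn subr0.
have [nN|/ltnW Nn] := leqP n N; last by rewrite lerB// nondecreasing_cvgn_le.
by rewrite subrr subr_ge0 nondecreasing_cvgn_le.
Qed.

Lemma limn_tail_small (R : realType) (b : nat -> R) (e : R) :
  cvgn (series b) -> 0 < e ->
  exists N, limn (series b) - series b N < e.
Proof.
move=> cb e0; have /cvgrPdist_lt/(_ e e0)[N _ hN] := cb.
by exists N; apply: le_lt_trans (hN N (leqnn N)); exact: ler_norm.
Qed.

Lemma trunc_dense (R : realType) (x : ell2 R) (e : R) : 0 < e ->
  exists N, rnorm (x - trunc N x) < e.
Proof.
move=> e0; have [N hN] := limn_tail_small (@ell2_cvg _ x) (exprn_gt0 2 e0).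
exists N; rewrite -(@ltr_pXn2r _ 2) ?nnegrE ?rnorm_ge0 ?(ltW e0)//.
apply: le_lt_trans hN; apply: rnorm_sub_trunc => //; exact: ell2_cvg.
Qed.

Definition delta_ell2 (R : realType) n : ell2 R :=
  trunc n.+1 (fun m => (m == n)%:R).

Lemma delta_ell2E (R : realType) n m : delta_ell2 R n m = (m == n)%:R.
Proof.
rewrite /delta_ell2 truncE; case: ifP => // /negbT; rewrite -leqNgt.
by case: eqP => // -> /[!ltnn].
Qed.

Lemma ell2_coord_sum (R : realType) (I : finType) (f : I -> ell2 R) n :
  (\sum_i f i) n = \sum_i f i n.
Proof. by apply: (big_morph (fun x : ell2 R => x n)). Qed.

Lemma trunc_sum (R : realType) N (f : nat -> R[i]) :
  trunc N f = \sum_(i < N) f i *: delta_ell2 R i.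
Proof.
apply: ell2_ext => n; rewrite ell2_coord_sum truncE.
under eq_bigr do rewrite ell2_coordZ delta_ell2E.
case: ltnP => [nN|Nn].
  rewrite (bigD1 (Ordinal nN))//= eqxx mulr1 big1 ?addr0// => i iN.
  by case: eqP => [ni|_]; rewrite ?mulr0//; case/eqP: iN; exact: val_inj.
rewrite big1// => i _; case: eqP => [ni|_]; rewrite ?mulr0//.
by move: (ltn_ord i); rewrite -ni ltnNge Nn.
Qed.

Lemma ell2_inner_delta (R : realType) n (y : ell2 R) :
  ell2_inner (delta_ell2 R n) y = (y n)^*.
Proof.
apply: cvg_lim; first exact: norm_hausdorff.
apply: cvg_near_cst; exists n.+1 => // N nN.
change (series (fun k => delta_ell2 R n k * (y k)^*) N = (y n)^*).
rewrite /series [LHS](bigD1_seq n) ?mem_index_iota ?iota_uniq//.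
rewrite delta_ell2E eqxx mul1r big1 => [|k kn]; first exact: addr0.
by rewrite delta_ell2E (negbTE kn) mul0r.
Qed.

(** * Hilbert-Schmidt operators *)

Lemma hs_seq_le (R : realType) (r : nat -> ell2 R)
  (rs : cvgn (series (fun n => rnorm (r n) ^+ 2))) (x : ell2 R) n :
  series (sqmod (fun n => ell2_inner x (r n))) n <=
    rnorm x ^+ 2 * limn (series (fun n => rnorm (r n) ^+ 2)).
Proof.
apply: (@le_trans _ _
  (rnorm x ^+ 2 * series (fun n => rnorm (r n) ^+ 2) n)).
  rewrite /series/= mulr_sumr; apply: ler_sum => k _.
  rewrite /sqmod -exprMn ler_pXn2r ?nnegrE ?normc_ge0 ?mulr_ge0 ?rnorm_ge0//.
  exact: normc_inner_le.
rewrite ler_wpM2l ?sqr_ge0// nondecreasing_cvgn_le//.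
by apply: nondecreasing_series => k _ _; exact: sqr_ge0.
Qed.

(** The operator whose matrix has the conjugates of the vectors [r n] as rows;
[rs] says that it is Hilbert-Schmidt. With this choice of rows the coordinates
of the image are inner products, so that linearity and all the estimates follow
from the properties of the inner product. *)
Definition hs_op (R : realType) (r : nat -> ell2 R)
    (rs : cvgn (series (fun n => rnorm (r n) ^+ 2))) (x : ell2 R) : ell2 R :=
  Ell2 (square_summable_le (hs_seq_le rs x)).

Lemma hs_opE (R : realType) (r : nat -> ell2 R)
    (rs : cvgn (series (fun n => rnorm (r n) ^+ 2))) (x : ell2 R) n :
  hs_op rs x n = ell2_inner x (r n).
Proof. by []. Qed.

Lemma hs_op_linear (R : realType) (r : nat -> ell2 R)
    (rs : cvgn (series (fun n => rnorm (r n) ^+ 2))) : linear (hs_op rs).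
Proof.
move=> a x y; apply: ell2_ext => n.
by rewrite ell2_coordD ell2_coordZ !hs_opE ell2_innerP.
Qed.

HB.instance Definition _ (R : realType) (r : nat -> ell2 R)
    (rs : cvgn (series (fun n => rnorm (r n) ^+ 2))) :=
  GRing.isLinear.Build R[i] (ell2 R) (ell2 R) _ (hs_op rs) (hs_op_linear rs).

Lemma hs_op_matrix (R : realType) (r : nat -> ell2 R)
    (rs : cvgn (series (fun n => rnorm (r n) ^+ 2))) :
  matrix_operator (fun n m => (r n m)^*) (hs_op rs).
Proof.
move=> x n; rewrite hs_opE.
rewrite (_ : (fun m => (r n m)^* * x m) = (fun m => x m * (r n m)^*)).
  exact: ell2_inner_lim.
by apply/funext => m; rewrite mulrC.
Qed.

Lemma hs_op_bound (R : realType) (r : nat -> ell2 R)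
    (rs : cvgn (series (fun n => rnorm (r n) ^+ 2))) :
  exists2 M : R, 0 < M & forall x, rnorm (hs_op rs x) <= M * rnorm x.
Proof.
set D := limn (series (fun n => rnorm (r n) ^+ 2)).
have nd : nondecreasing_seq (series (fun n => rnorm (r n) ^+ 2)).
  by apply: nondecreasing_series => k _ _; exact: sqr_ge0.
have D0 : 0 <= D.
  apply: le_trans (nondecreasing_cvgn_le nd rs 0%N).
  by rewrite /series/= big_nil.
(* the summand 1 only serves to make the bound positive *)
exists (Num.sqrt D + 1) => [|x]; first by rewrite ltr_wpDl ?sqrtr_ge0.
apply: rnorm_le => [|n]; first by rewrite mulr_ge0 ?rnorm_ge0 ?addr_ge0 ?sqrtr_ge0.
apply: le_trans (hs_seq_le rs x n) _.
rewrite mulrC exprMn ler_wpM2r ?sqr_ge0// -/D.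
rewrite -{1}(sqr_sqrtr D0) ler_pXn2r ?nnegrE ?addr_ge0 ?sqrtr_ge0//.
by rewrite lerDl.
Qed.

Lemma bounded_operator_rnorm (R : realType) (T : ell2 R -> ell2 R) (M : R) :
  (forall x, rnorm (T x) <= M * rnorm x) -> bounded_operator T.
Proof.
by move=> TM; exists M => x; rewrite !ell2_normrE -rmorphM/= lecR.
Qed.

(** The identity holds on the basis vectors, where it is the symmetry of the
matrix, hence on truncations by linearity, hence everywhere by density and
continuity. *)
Lemma hs_op_self_adjoint (R : realType) (r : nat -> ell2 R)
    (rs : cvgn (series (fun n => rnorm (r n) ^+ 2))) :
  (forall n m, r n m = (r m n)^*) -> self_adjoint (hs_op rs).
Proof.
move=> rh x y.
have Tdelta n : ell2_inner (hs_op rs (delta_ell2 R n)) y =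
    ell2_inner (delta_ell2 R n) (hs_op rs y).
  rewrite ell2_inner_delta hs_opE -ell2_innerC; congr ell2_inner.
  by apply: ell2_ext => m; rewrite hs_opE ell2_inner_delta -rh.
have Ttrunc N : ell2_inner (hs_op rs (trunc N x)) y =
    ell2_inner (trunc N x) (hs_op rs y).
  rewrite trunc_sum linear_sum/= !ell2_inner_suml; apply: eq_bigr => i _.
  by rewrite linearZ/= !ell2_innerZl Tdelta.
have [M M0 TM] := hs_op_bound rs.
apply/eqP; rewrite -subr_eq0 -normr_eq0 normc_normr.
set c := normc _; suff -> : c = 0 by [].
apply/eqP; rewrite eq_le normc_ge0 andbT; apply/ler_addgt0Pr => e e0.
rewrite add0r.
have K0 : 0 < (2 * M * rnorm y + 1).
  by rewrite ltr_wpDl// mulr_ge0 ?rnorm_ge0// mulr_ge0// ltW.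
have [N hN] := trunc_dense x (divr_gt0 e0 K0).
set d := x - trunc N x in hN.
have -> : c = normc (ell2_inner (hs_op rs d) y - ell2_inner d (hs_op rs y)).
  rewrite /c /d; congr normc; rewrite linearB/= !ell2_innerBl Ttrunc.
  by rewrite opprB addrA subrK.
apply: (@le_trans _ _ (rnorm d * (2 * M * rnorm y))).
  apply: le_trans (le_normcD _ _) _; rewrite normcN.
  apply: (@le_trans _ _ (M * rnorm d * rnorm y + rnorm d * (M * rnorm y))).
    apply: lerD; apply: le_trans (normc_inner_le _ _) _.
      by rewrite ler_wpM2r ?rnorm_ge0.
    by rewrite ler_wpM2l ?rnorm_ge0.
  by rewrite le_eqVlt; apply/orP; left; apply/eqP; ring.
apply: (@le_trans _ _ (rnorm d * (2 * M * rnorm y + 1))).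
  by rewrite ler_wpM2l ?rnorm_ge0// lerDl.
by rewrite -ler_pdivlMr// ltW.
Qed.

(** * Compactness of the Hilbert cube *)

(** Real and imaginary parts are indexed by [false] and [true], which makes the
Hilbert cube the image of a product of real segments. *)
Definition box (R : realType) (b : nat -> R) : set (nat * bool -> R) :=
  [set f | forall i, f i \in `[- b i.1, b i.1]].

Definition box_seq (R : realType) (f : nat * bool -> R) : nat -> R[i] :=
  fun n => (f (n, false) +i* f (n, true))%C.

(** The default value [0] is taken at sequences that are not square summable;
none of them is in a box with square-summable sides. *)
Definition box_ell2 (R : realType) (f : nat * bool -> R) : ell2 R :=
  insubd (0 : ell2 R) (box_seq f).

Lemma sqmod_box_seq (R : realType) (b : nat -> R) (f : nat * bool -> R) n :
  box b f -> sqmod (box_seq f) n <= 2 * b n ^+ 2.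
Proof.
move=> bf; rewrite /sqmod /box_seq/= sqr_sqrtr ?addr_ge0 ?sqr_ge0//.
by have := bf (n, false); have := bf (n, true); rewrite !in_itv/=; nra.
Qed.

Lemma box_ell2E (R : realType) (b : nat -> R) (f : nat * bool -> R) :
  cvgn (series (fun n => b n ^+ 2)) -> box b f ->
  ell2_seq (box_ell2 f) = box_seq f.
Proof.
move=> cb bf; rewrite /box_ell2 -[LHS]/(val _) insubdK//.
apply/asboolP; apply: (@series_le_cvg _ _ (fun n => 2 * b n ^+ 2)).
- by move=> n; exact: sqmod_ge0.
- by move=> n; rewrite mulr_ge0 ?sqr_ge0.
- by move=> n; exact: sqmod_box_seq.
- exact: is_cvg_series_scale.
Qed.

Lemma box_seq_coord_near (R : realType) (X : topologicalType)
  (c : X -> nat * bool -> R) (x : X) N (e : R) :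
  (forall i, continuous (fun h => c h i)) -> 0 < e ->
  \forall h \near x, series (sqmod (box_seq (c x) - box_seq (c h))) N < e.
Proof.
move=> cc.
have pc i d : 0 < d -> \forall h \near x, (c x i - c h i) ^+ 2 < d :> R.
  move=> d0; have sd0 : 0 < Num.sqrt d by rewrite sqrtr_gt0.
  have hn : \forall h \near x, `|c x i - c h i| < Num.sqrt d.
    exact: (cvgr_dist_lt _ (c x i) (cc i x)).
  apply: filterS hn => h hd.
  suff : `|c x i - c h i| ^+ 2 < Num.sqrt d ^+ 2.
    by rewrite (sqr_sqrtr (ltW d0)) real_normK// num_real.
  by rewrite ltr_pXn2r ?nnegrE ?sqrtr_ge0.
elim: N e => [|N IH] e e0.
  by apply: nearW => h; rewrite /series/= big_nil.
have e2 : 0 < e / 2 by rewrite divr_gt0.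
have e4 : 0 < e / 2 / 2 by rewrite divr_gt0.
apply: filterS3 (IH _ e2) (pc (N, false) _ e4) (pc (N, true) _ e4) => h h1 h2 h3.
rewrite seriesSr (splitr e) ltrD//.
by rewrite /sqmod /= sqr_sqrtr ?addr_ge0 ?sqr_ge0// (splitr (e / 2)) ltrD.
Qed.

(** Pointwise convergence controls finitely many coordinates, and the tails are
uniformly small on the box. The domain is an arbitrary topological space with
continuous coordinates; the product topology is the intended instance. *)
Lemma box_ell2_continuous (R : realType) (b : nat -> R) (X : topologicalType)
    (c : X -> nat * bool -> R) :
  cvgn (series (fun n => b n ^+ 2)) -> (forall i, continuous (fun h => c h i)) ->
  {within c @^-1` box b, continuous (fun h => box_ell2 (c h))}.
Proof.
move=> cb cc; apply/subspace_continuousP => x bx; apply/cvgrPdist_lt => e' e'0.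
have e'E : e' = (complex.Re e')%:C by rewrite RRe_real// gtr0_real.
set e := complex.Re e' in e'E.
have e0 : 0 < e by rewrite -ltcR -e'E.
have e3 : 0 < e / 3 by rewrite divr_gt0.
have cb2 : cvgn (series (fun n => 2 * b n ^+ 2)) by exact: is_cvg_series_scale.
have [N hN] := limn_tail_small cb2 (exprn_gt0 2 e3).
have near_trunc h : box b h -> rnorm (box_ell2 h - trunc N (box_ell2 h)) < e / 3.
  move=> bh; rewrite -(@ltr_pXn2r _ 2) ?nnegrE ?rnorm_ge0 ?(ltW e3)//.
  apply: le_lt_trans hN; apply: rnorm_sub_trunc => // n.
  by rewrite (box_ell2E cb bh) sqmod_box_seq.
have cl := @box_seq_coord_near R X c x N _ cc (exprn_gt0 2 e3).
rewrite /within /= ; apply: filterS cl => h /= hcl bh.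
rewrite e'E ell2_normrE ltcR.
have nx := near_trunc _ bx; have nh := near_trunc _ bh.
set u := box_ell2 (c x) in nx *; set v := box_ell2 (c h) in nh *.
have nxh : rnorm (trunc N u - trunc N v) < e / 3.
  rewrite -(@ltr_pXn2r _ 2) ?nnegrE ?rnorm_ge0 ?(ltW e3)// truncB.
  apply: le_lt_trans (rnorm_trunc_sqr _ _) _.
  by rewrite /u /v (box_ell2E cb bx) (box_ell2E cb bh).
have eE : e / 3 + (e / 3 + e / 3) = e by field.
rewrite -eE; apply: le_lt_trans (rnorm_triangle (trunc N u) _ _) _.
apply: ltrD nx _; apply: le_lt_trans (rnorm_triangle (trunc N v) _ _) _.
by apply: ltrD nxh _; rewrite rnorm_distC.
Qed.

Lemma box_compact (R : realType) (b : nat -> R) :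
  compact (box b : set (prod_topology (fun _ : nat * bool => R))).
Proof.
have := @tychonoff (nat * bool)%type (fun _ => R)
  (fun i => `[- b i.1, b i.1]%classic).
by apply => i; exact: segment_compact.
Qed.

(** By Tychonoff's theorem the box is compact for pointwise convergence, and its
image in [ell2 R] covers the cube. *)
Lemma hilbert_cube_precompact (R : realType) (b : nat -> R) :
  cvgn (series (fun n => b n ^+ 2)) ->
  precompact [set x : ell2 R | forall n, normc (x n) <= b n].
Proof.
move=> cb; apply: (@precompact_subset _ _ (@box_ell2 R @` box b)).
  move=> x xb; pose f := fun i : nat * bool =>
    if i.2 then complex.Im (x i.1) else complex.Re (x i.1).
  have bf : box b f.
    case=> n c; rewrite in_itv/= -ler_norml; apply: le_trans (xb n).
    rewrite /f/=; case: (x n) c => u v [] /=; rewrite -sqrtr_sqr ler_wsqrtr//.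
      by rewrite lerDr sqr_ge0.
    by rewrite lerDl sqr_ge0.
  exists f => //; apply: ell2_ext => n; rewrite (box_ell2E cb bf) /box_seq /f/=.
  by case: (x n).
apply: compact_precompact; first exact: norm_hausdorff.
apply: (@continuous_compact (prod_topology (fun _ : nat * bool => R))).
  apply: (@box_ell2_continuous R b (prod_topology (fun _ : nat * bool => R)) id cb).
  by move=> i; exact: (@proj_continuous _ (fun _ : nat * bool => R) i).
exact: box_compact.
Qed.

(** The image of a ball lies in the Hilbert cube with sides proportional to
[rnorm (r n)], by the Cauchy-Schwarz inequality in each coordinate. *)
Lemma hs_op_compact (R : realType) (r : nat -> ell2 R)
    (rs : cvgn (series (fun n => rnorm (r n) ^+ 2))) :
  compact_operator (hs_op rs).
Proof.
move=> B /ex_strict_bound_gt0[M M0 BM].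
have ME : M = (complex.Re M)%:C by rewrite RRe_real// gtr0_real.
set m := complex.Re M in ME.
apply: (@precompact_subset _ _
    [set y : ell2 R | forall n, normc (y n) <= m * rnorm (r n)]); last first.
  apply: hilbert_cube_precompact.
  rewrite (_ : (fun n => _) = (fun n => m ^+ 2 * rnorm (r n) ^+ 2)).
    exact: is_cvg_series_scale.
  by apply/funext => n; rewrite exprMn.
move=> _ [x Bx <-] n; rewrite hs_opE.
apply: le_trans (normc_inner_le _ _) _; rewrite ler_wpM2r ?rnorm_ge0//.
by have := BM x Bx; rewrite /= ME ell2_normrE ltcR => /ltW.
Qed.

(** * Bessel's inequality and the Hilbert-Schmidt bound *)

Definition rdot (R : realType) (x y : ell2 R) : R := complex.Re (ell2_inner x y).

Lemma rdotDl (R : realType) (x y z : ell2 R) : rdot (x + y) z = rdot x z + rdot y z.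
Proof. by rewrite /rdot ell2_innerDl raddfD. Qed.

Lemma rdotNl (R : realType) (x z : ell2 R) : rdot (- x) z = - rdot x z.
Proof. by rewrite /rdot ell2_innerNl raddfN. Qed.

Lemma rdotZl (R : realType) (t : R) (x z : ell2 R) :
  rdot (t%:C *: x) z = t * rdot x z.
Proof.
rewrite /rdot ell2_innerZl; case: (ell2_inner x z) => a b /=.
by rewrite mul0r subr0.
Qed.

Lemma rdotC (R : realType) (x y : ell2 R) : rdot x y = rdot y x.
Proof. by rewrite /rdot ell2_innerC; case: (ell2_inner y x). Qed.

Lemma rdotDr (R : realType) (x y z : ell2 R) : rdot z (x + y) = rdot z x + rdot z y.
Proof. by rewrite ![rdot z _]rdotC rdotDl. Qed.

Lemma rdotZr (R : realType) (t : R) (x z : ell2 R) :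
  rdot z (t%:C *: x) = t * rdot z x.
Proof. by rewrite ![rdot z _]rdotC rdotZl. Qed.

Lemma rdotxx (R : realType) (x : ell2 R) : rdot x x = rnorm x ^+ 2.
Proof. by rewrite /rdot ell2_innerxx ell2_normrE -rmorphXn. Qed.

Lemma rdot_le (R : realType) (x y : ell2 R) : `|rdot x y| <= rnorm x * rnorm y.
Proof.
apply: le_trans (normc_inner_le x y).
by rewrite -lecR -normc_normr normc_ge_Re.
Qed.

Lemma normcR (R : realType) (t : R) : normc t%:C = `|t|.
Proof. by rewrite /= expr0n/= addr0 sqrtr_sqr. Qed.

Lemma bessel (R : realType) k (u : 'I_k -> ell2 R) (x : ell2 R) :
  (forall i j, ell2_inner (u i) (u j) = (i == j)%:R) ->
  \sum_i normc (ell2_inner x (u i)) ^+ 2 <= rnorm x ^+ 2.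
Proof.
move=> uo; pose c i := ell2_inner x (u i); pose p := \sum_i c i *: u i.
have pu i : ell2_inner p (u i) = c i.
  rewrite /p ell2_inner_suml (bigD1 i)//= ell2_innerZl uo eqxx mulr1.
  rewrite big1 ?addr0// => j ji.
  by rewrite ell2_innerZl uo (negbTE ji) mulr0.
have xp : ell2_inner x p = \sum_i `|c i| ^+ 2.
  rewrite /p ell2_inner_sumr; apply: eq_bigr => i _.
  by rewrite ell2_innerZr -/(c i) mulrC normCK.
have pp : ell2_inner p p = \sum_i `|c i| ^+ 2.
  rewrite {2}/p ell2_inner_sumr; apply: eq_bigr => i _.
  by rewrite ell2_innerZr pu mulrC normCK.
have s0 : 0 <= \sum_i `|c i| ^+ 2 by apply: sumr_ge0 => i _; rewrite exprn_ge0.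
have px : ell2_inner p x = \sum_i `|c i| ^+ 2.
  by rewrite ell2_innerC xp (conj_Creal (ger0_real s0)).
have : 0 <= ell2_inner (x - p) (x - p) by rewrite ell2_innerxx exprn_ge0.
rewrite ell2_innerBl !ell2_innerBr pp xp px subrr subr0 subr_ge0.
rewrite ell2_innerxx ell2_normrE -rmorphXn/=.
rewrite (_ : \sum_i `|c i| ^+ 2 = (\sum_i normc (c i) ^+ 2)%:C) ?lecR//.
by rewrite rmorph_sum; apply: eq_bigr => i _; rewrite rmorphXn.
Qed.

Lemma sum_lim_le (R : realType) k (a : nat -> nat -> R) (A : nat -> R) (D : R) :
  (forall i, (i < k)%N -> a i @ \oo --> A i) ->
  (forall n, \sum_(i < k) a i n <= D) -> \sum_(i < k) A i <= D.
Proof.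
move=> aA aD.
have cv : (fun n => \sum_(i < k) a i n) @ \oo --> \sum_(i < k) A i.
  elim: k aA {aD} => [|k IH] aA.
    rewrite big_ord0; under eq_fun do rewrite big_ord0; exact: cvg_cst.
  rewrite big_ord_recr/=; under eq_fun do rewrite big_ord_recr/=.
  by apply: cvgD; [apply: IH => i ik; apply: aA; exact: ltnW|exact: aA].
have cvn : cvgn (fun n => \sum_(i < k) a i n) by apply/cvg_ex; eexists; exact: cv.
have <- : limn (fun n => \sum_(i < k) a i n) = \sum_(i < k) A i.
  exact/cvg_lim.
by apply: limr_le => //; apply: nearW.
Qed.

(** In each coordinate [m] the sum over the family is at most [rnorm (r m) ^+ 2] by
Bessel's inequality for the row [r m]. This bounds the number of orthonormal
eigenvectors whose eigenvalues stay away from [0]. *)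
Lemma hs_op_sum_le (R : realType) (r : nat -> ell2 R)
    (rs : cvgn (series (fun n => rnorm (r n) ^+ 2))) k (u : nat -> ell2 R) :
  (forall i j, (i < k)%N -> (j < k)%N -> ell2_inner (u i) (u j) = (i == j)%:R) ->
  \sum_(i < k) rnorm (hs_op rs (u i)) ^+ 2 <=
    limn (series (fun n => rnorm (r n) ^+ 2)).
Proof.
move=> uo; apply: (@sum_lim_le _ k (fun i => series (sqmod (hs_op rs (u i))))
  (fun i => rnorm (hs_op rs (u i)) ^+ 2)).
  by move=> i _; rewrite rnorm_sqr; exact: ell2_cvg.
move=> n; rewrite /series exchange_big.
apply: (@le_trans _ _ (series (fun n => rnorm (r n) ^+ 2) n)).
  apply: ler_sum => m _.
  apply: le_trans (@bessel _ k (fun i => u i) (r m) _); last first.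
    by move=> i j; rewrite uo.
  rewrite le_eqVlt; apply/orP; left; apply/eqP; apply: eq_bigr => i _.
  by rewrite /sqmod hs_opE [in RHS]ell2_innerC normc_conj.
apply: nondecreasing_cvgn_le => //.
by apply: nondecreasing_series => i _ _; exact: sqr_ge0.
Qed.

(** * Maximization of the quadratic form *)

Definition qform (R : realType) (T : ell2 R -> ell2 R) (x : ell2 R) : R :=
  rdot (T x) x.

(** The inner products are complex, so that this is a complex subspace, although
[qform] and [rdot] only retain real parts. *)
Definition orthocomp (R : realType) (U : set (ell2 R)) : set (ell2 R) :=
  [set x | forall u, U u -> ell2_inner x u = 0].

Lemma orthocompP (R : realType) (U : set (ell2 R)) a (x y : ell2 R) :
  orthocomp U x -> orthocomp U y -> orthocomp U (a *: x + y).
Proof.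
by move=> xU yU u Uu; rewrite ell2_innerP xU// yU// mulr0 addr0.
Qed.

Lemma orthocomp0 (R : realType) (U : set (ell2 R)) : orthocomp U 0.
Proof. by move=> u _; rewrite ell2_inner0l. Qed.

Lemma orthocompZ (R : realType) (U : set (ell2 R)) a (x : ell2 R) :
  orthocomp U x -> orthocomp U (a *: x).
Proof.
by move=> xU; rewrite -[_ *: _]addr0; apply: orthocompP => //; exact: orthocomp0.
Qed.

Lemma orthocompB (R : realType) (U : set (ell2 R)) (x y : ell2 R) :
  orthocomp U x -> orthocomp U y -> orthocomp U (x - y).
Proof.
by move=> xU yU; rewrite addrC -scaleN1r; exact: orthocompP.
Qed.

Lemma qformZ (R : realType) (T : {linear ell2 R -> ell2 R}) (t : R) (x : ell2 R) :
  qform T (t%:C *: x) = t ^+ 2 * qform T x.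
Proof. by rewrite /qform linearZ/= rdotZl rdotZr mulrA. Qed.

Lemma qform_le (R : realType) (T : ell2 R -> ell2 R) (M : R) (x : ell2 R) :
  (forall x, rnorm (T x) <= M * rnorm x) -> `|qform T x| <= M * rnorm x ^+ 2.
Proof.
move=> TM; apply: le_trans (rdot_le _ _) _.
by rewrite expr2 mulrA ler_wpM2r ?rnorm_ge0.
Qed.

Lemma rnorm_normalized (R : realType) (x : ell2 R) :
  x != 0 -> rnorm ((rnorm x)^-1%:C *: x) = 1.
Proof.
move=> x0; rewrite rnormZ normcR ger0_norm ?invr_ge0 ?rnorm_ge0//.
by rewrite mulVf// rnorm_eq0.
Qed.

(** The form [S |x|^2 - <T x, x>] is nonnegative on the orthogonal complement of
[U] and at most [(S + M) |x|^2]; evaluating it at [x - t z], where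
[z = S x - T x] and [t = 1 / (S + M)], bounds the norm of [z]. Thus almost
maximizers of the quadratic form are almost eigenvectors. *)
Lemma defect_le (R : realType) (T : {linear ell2 R -> ell2 R}) (M S : R)
    (U : set (ell2 R)) (x : ell2 R) :
  0 < M -> (forall x, rnorm (T x) <= M * rnorm x) -> self_adjoint T ->
  (forall x, orthocomp U x -> orthocomp U (T x)) -> 0 < S ->
  (forall x, orthocomp U x -> qform T x <= S * rnorm x ^+ 2) ->
  orthocomp U x ->
  rnorm (S%:C *: x - T x) ^+ 2 <= (S + M) * (S * rnorm x ^+ 2 - qform T x).
Proof.
move=> M0 TM TS TU S0 QS xU.
have [z zE] : exists z, z = S%:C *: x - T x by eexists.
rewrite -zE.
have zU : orthocomp U z.
  by rewrite zE; apply: orthocompB; [exact: orthocompZ|exact: TU].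
have L0 : 0 < S + M by exact: addr_gt0.
pose t := (S + M)^-1.
have h := QS _ (orthocompP (- t)%:C zU xU).
have TSr a b : rdot (T a) b = rdot a (T b) by rewrite /rdot TS.
have zz : rnorm z ^+ 2 = S * rdot x z - rdot (T x) z.
  by rewrite -rdotxx {1}zE rdotDl rdotNl rdotZl.
have qz : - (M * rnorm z ^+ 2) <= qform T z.
  by have := qform_le z TM; rewrite ler_norml => /andP[].
have E1 : rnorm ((- t)%:C *: z + x) ^+ 2 =
    t ^+ 2 * rnorm z ^+ 2 - 2 * t * rdot x z + rnorm x ^+ 2.
  rewrite -!rdotxx !(rdotDl, rdotDr, rdotZl, rdotZr) (rdotC z x); ring.
have E2 : qform T ((- t)%:C *: z + x) =
    t ^+ 2 * qform T z - 2 * t * rdot (T x) z + qform T x.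
  rewrite /qform linearD linearZ/= !(rdotDl, rdotDr, rdotZl, rdotZr).
  rewrite (TSr z x) (rdotC z); ring.
move: h; rewrite E1 E2.
have tL : t * (S + M) = 1 by rewrite /t mulVf// gt_eqF.
have t0 : 0 < t by rewrite invr_gt0.
move: zz qz; set a := rnorm z ^+ 2; set b := rdot x z; set c := rdot (T x) z.
set d := qform T z; set e := rnorm x ^+ 2; set f := qform T x.
move=> zz qz h.
have h1 : t ^+ 2 * (- (M * a)) <= t ^+ 2 * d by rewrite ler_wpM2l ?sqr_ge0.
have h2 : t * a <= S * e - f.
  rewrite -subr_ge0.
  rewrite (_ : S * e - f - t * a = (S * (t ^+ 2 * a - 2 * t * b + e) -
    (t ^+ 2 * d - 2 * t * c + f)) + (t ^+ 2 * d - t ^+ 2 * (- (M * a)))).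
    by rewrite addr_ge0 ?subr_ge0.
  rewrite (_ : c = S * b - a); last by rewrite zz; ring.
  transitivity (S * e - f - t * a + t * a * (t * (S + M) - 1)); last by ring.
  by rewrite tL subrr mulr0 addr0.
have := ler_wpM2l (ltW L0) h2; rewrite mulrA (mulrC _ t) tL mul1r.
by [].
Qed.

(** Sequential form of the compactness of [T] on the unit ball. *)
Lemma compact_cluster (R : realType) (T : ell2 R -> ell2 R) (x : nat -> ell2 R) :
  compact_operator T -> (forall j, rnorm (x j) <= 1) ->
  exists y, forall (e : R) N, 0 < e ->
    exists2 j, (N <= j)%N & rnorm (T (x j) - y) < e.
Proof.
move=> TC x1; pose B : set (ell2 R) := [set x | rnorm x <= 1].
have Bb : bounded_set B.
  exists 1; split=> [|M M1 z zB]; first exact: real1.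
  by rewrite /= ell2_normrE; apply: le_trans (ltW M1); rewrite -[1]/(1%:C) lecR.
have := TC B Bb; rewrite precompactE => cB.
have FB : ((fun j => T (x j)) @ \oo) (closure (T @` B)).
  exists 0%N => // j _ /=; apply: subset_closure; exists (x j) => //.
  exact: x1.
have [y [_ cy]] := cB _ _ FB.
exists y => e N e0.
have h1 : ((fun j => T (x j)) @ \oo) [set z | exists2 j, (N <= j)%N & z = T (x j)].
  by exists N => // j /= Nj; exists j.
have h2 : nbhs y (ball y (e%:C : R[i])) by apply: nbhsx_ballx; rewrite ltcR.
have [_ [[j Nj ->]]] := cy _ _ h1 h2.
rewrite -ball_normE /= ell2_normrE ltcR rnorm_distC => h.
by exists j.
Qed.

(** The supremum [S] of the quadratic form over the unit ball of the orthogonal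
complement of [U] is an eigenvalue: the images of a maximizing sequence have a
cluster point by compactness, and [defect_le] shows that it is an eigenvector
for [S]. It is nonzero because [S] is. *)
Lemma spectral_step (R : realType) (T : {linear ell2 R -> ell2 R}) (M : R)
    (U : set (ell2 R)) (x0 : ell2 R) :
  0 < M -> (forall x, rnorm (T x) <= M * rnorm x) -> self_adjoint T ->
  compact_operator T ->
  (forall x, orthocomp U x -> orthocomp U (T x)) ->
  orthocomp U x0 -> 0 < qform T x0 ->
  exists l : R, exists y, [/\ 0 < l, orthocomp U y, rnorm y = 1 & T y = l%:C *: y].
Proof.
move=> M0 TM TS TC TU x0U qx0.
pose W := [set qform T x | x in [set x | orthocomp U x /\ rnorm x <= 1]].
have Wub : ubound W M.
  move=> _ [x [xU x1] <-]; apply: le_trans (ler_norm _) _.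
  apply: le_trans (qform_le _ TM) _.
  by rewrite ler_piMr ?(ltW M0)// exprn_ile1 ?rnorm_ge0.
have x00 : x0 != 0.
  by apply: contraTneq qx0 => ->; rewrite /qform linear0 /rdot ell2_inner0l ltxx.
have Wnormed x : orthocomp U x -> x != 0 -> W (rnorm x ^- 2 * qform T x).
  move=> xU xn0; exists ((rnorm x)^-1%:C *: x).
    by split; [exact: orthocompZ|rewrite rnorm_normalized].
  by rewrite qformZ exprVn.
have Wsup : has_sup W.
  by split; [exists (rnorm x0 ^- 2 * qform T x0); exact: Wnormed|exists M].
pose S := sup W.
have S0 : 0 < S.
  apply: (@lt_le_trans _ _ (rnorm x0 ^- 2 * qform T x0)).
    rewrite mulr_gt0// invr_gt0 exprn_gt0// lt_neqAle eq_sym rnorm_eq0 x00.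
    exact: rnorm_ge0.
  by apply: sup_upper_bound => //; exact: Wnormed.
have QS x : orthocomp U x -> qform T x <= S * rnorm x ^+ 2.
  move=> xU; have [->|xn0] := eqVneq x 0.
    by rewrite /qform linear0 /rdot ell2_inner0l rnorm0 expr0n mulr0.
  have xp : 0 < rnorm x ^+ 2.
    by rewrite exprn_gt0// lt_neqAle eq_sym rnorm_eq0 xn0 rnorm_ge0.
  by rewrite -ler_pdivrMr// mulrC; apply: sup_upper_bound => //; exact: Wnormed.
have approx (j : nat) : exists x,
    [/\ orthocomp U x, rnorm x <= 1 & S - j.+1%:R^-1 < qform T x].
  have j0 : 0 < j.+1%:R^-1 :> R by rewrite invr_gt0.
  have [_ [x [xU x1] <-] h] := sup_adherent j0 Wsup.
  by exists x.
have [x xP] := choice approx.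
have [y yP] := compact_cluster TC (fun j => (let: And3 _ h _ := xP j in h)).
have L0 : 0 < S + M by exact: addr_gt0.
have near_eigen (e : R) : 0 < e -> exists z,
    [/\ orthocomp U z, rnorm z <= 1, rnorm (T z - y) < e,
        rnorm (S%:C *: z - T z) < e & S - e < qform T z].
  move=> e0; pose d := Num.min e (e ^+ 2 / (S + M)).
  have d0 : 0 < d by rewrite lt_min e0 divr_gt0// exprn_gt0.
  have [N _ hN] := near_infty_natSinv_lt (PosNum d0).
  have [j Nj hj] := yP _ N e0.
  have [zU z1 zS] := xP j.
  have hd : S - d < qform T (x j).
    by apply: lt_trans zS; rewrite ltrD2l ltrN2; exact: (hN j Nj).
  exists (x j); split => //.
    rewrite -(@ltr_pXn2r _ 2) ?nnegrE ?rnorm_ge0 ?(ltW e0)//.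
    apply: le_lt_trans (defect_le M0 TM TS TU S0 QS zU) _.
    rewrite mulrC -ltr_pdivlMr//.
    apply: (@le_lt_trans _ _ (S - qform T (x j))).
      by rewrite lerD2r ler_piMr ?(ltW S0)// exprn_ile1 ?rnorm_ge0.
    have : d <= e ^+ 2 / (S + M) by rewrite ge_min lexx orbT.
    by apply: lt_le_trans; rewrite ltrBlDr addrC -ltrBlDr.
  by apply: le_lt_trans hd; rewrite lerD2l lerN2 ge_min lexx.
have yU : orthocomp U y.
  move=> u Uu; apply: eq0_normc; apply/eqP; rewrite eq_le normc_ge0 andbT.
  apply/ler_addgt0Pr => e e0; rewrite add0r.
  have K0 : 0 < rnorm u + 1 by rewrite ltr_wpDl ?rnorm_ge0.
  have [z [zU z1 h1 _ _]] := near_eigen _ (divr_gt0 e0 K0).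
  have -> : ell2_inner y u = - ell2_inner (T z - y) u.
    by rewrite ell2_innerBl (TU _ zU _ Uu) sub0r opprK.
  rewrite normcN; apply: le_trans (normc_inner_le _ _) _.
  apply: (@le_trans _ _ (rnorm (T z - y) * (rnorm u + 1))).
    by rewrite ler_wpM2l ?rnorm_ge0// lerDl.
  by rewrite -ler_pdivlMr// ltW.
have Ty : T y = S%:C *: y.
  apply/eqP; rewrite -subr_eq0 -rnorm_eq0 eq_le rnorm_ge0 andbT.
  apply/ler_addgt0Pr => e e0; rewrite add0r.
  have K0 : 0 < M + M + S by rewrite !addr_gt0.
  have [z [zU z1 h1 h2 _]] := near_eigen _ (divr_gt0 e0 K0).
  have -> : T y - S%:C *: y =
      - T (T z - y) - T (S%:C *: z - T z) + S%:C *: (T z - y).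
    have TB a b : T (a - b) = T a - T b by exact: linearB.
    have TZ a : T (S%:C *: a) = S%:C *: T a by exact: linearZ.
    by rewrite !TB TZ scalerBr !opprB !subrKA.
  apply: le_trans (rnormD _ _) _; rewrite rnormZ normcR (gtr0_norm S0).
  have t1 := rnormD (- T (T z - y)) (- T (S%:C *: z - T z)).
  rewrite !rnormN in t1.
  have t2 := TM (T z - y); have t3 := TM (S%:C *: z - T z).
  have t4 := ler_wpM2l (ltW M0) (ltW h1); have t5 := ler_wpM2l (ltW M0) (ltW h2).
  have t6 := ler_wpM2l (ltW S0) (ltW h1).
  have -> : e = M * (e / (M + M + S)) + M * (e / (M + M + S)) +
      S * (e / (M + M + S)).
    by rewrite -!mulrDl mulrC divfK// gt_eqF.
  apply: lerD t6; apply: le_trans t1 _.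
  by apply: lerD; [exact: le_trans t2 t4|exact: le_trans t3 t5].
have y0 : y != 0.
  apply: contraTneq S0 => y0; rewrite -leNgt; apply/ler_addgt0Pr => e e0.
  rewrite add0r.
  have [z [zU z1 h1 _ h3]] := near_eigen _ (divr_gt0 e0 (ltr0n R 2)).
  rewrite y0 subr0 in h1.
  have h4 : qform T z <= rnorm (T z).
    apply: le_trans (ler_norm _) _; apply: le_trans (rdot_le _ _) _.
    by rewrite ler_piMr ?rnorm_ge0.
  rewrite (splitr e); move: h3; rewrite ltrBlDr => h3.
  apply: ltW; apply: lt_trans h3 _; rewrite ltrD2r; exact: le_lt_trans h4 h1.
exists S, ((rnorm y)^-1%:C *: y); split => //.
- exact: orthocompZ.
- exact: rnorm_normalized.
- by rewrite linearZ/= Ty !scalerA mulrC.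
Qed.

(** * Infinitely many positive eigenvalues *)

(** This is where dimensions are compared: [k.+1] vectors have a nontrivial
combination orthogonal to [k] given ones. *)
Lemma nonzero_left_kernel (K : fieldType) k (A : 'M[K]_(k.+1, k)) :
  exists2 c : 'rV[K]_k.+1, c != 0 & c *m A = 0.
Proof.
have : kermx A != 0.
  by rewrite -mxrank_eq0 mxrank_ker -lt0n subn_gt0 ltnS rank_leq_col.
by move=> /rowV0Pn[c /sub_kermxP cA c0]; exists c.
Qed.

(** On combinations of the [w i] the quadratic form is positive definite. Given
[k] eigenvectors, some nonzero combination of [w 0, ..., w k] is orthogonal to
all of them, so that [spectral_step] applies in their orthogonal complement and
provides one more. *)
Lemma positive_eigenvectors (R : realType) (T : {linear ell2 R -> ell2 R}) (M : R)
    (w : nat -> ell2 R) (g : nat -> R) :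
  0 < M -> (forall x, rnorm (T x) <= M * rnorm x) -> self_adjoint T ->
  compact_operator T -> (forall i, 0 < g i) ->
  (forall i j, ell2_inner (T (w i)) (w j) = (i == j)%:R * (g i)%:C) ->
  forall k, exists (u : nat -> ell2 R) (l : nat -> R),
    (forall i j, (i < k)%N -> (j < k)%N -> ell2_inner (u i) (u j) = (i == j)%:R) /\
    (forall i, (i < k)%N -> 0 < l i /\ T (u i) = (l i)%:C *: u i).
Proof.
move=> M0 TM TS TC g0 wT; elim=> [|k [u [l [uo ul]]]].
  by exists (fun=> 0), (fun=> 0); split.
pose U := [set u i | i in [set i | (i < k)%N]].
have TU x : orthocomp U x -> orthocomp U (T x).
  move=> xU _ [i /= ik <-]; rewrite TS (ul i ik).2 ell2_innerZr xU ?mulr0//.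
  by exists i.
have [c c0 cA] := nonzero_left_kernel
  (\matrix_(i < k.+1, j < k) ell2_inner (w i) (u j)).
pose x0 := \sum_(i < k.+1) c 0 i *: w i.
have x0U : orthocomp U x0.
  move=> _ [j /= jk <-]; have /matrixP/(_ 0 (Ordinal jk)) := cA.
  rewrite !mxE => h; rewrite -[RHS]h /x0 ell2_inner_suml; apply: eq_bigr => i _.
  by rewrite mxE ell2_innerZl.
have qx0 : qform T x0 = \sum_(i < k.+1) normc (c 0 i) ^+ 2 * g i.
  apply: (@complexI R); rewrite rmorph_sum/=.
  rewrite (_ : (qform T x0)%:C = ell2_inner (T x0) x0); last first.
    rewrite /qform /rdot RRe_real//; apply/CrealP.
    by rewrite -ell2_innerC TS.
  rewrite /x0 linear_sum/= ell2_inner_suml; apply: eq_bigr => i _.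
  rewrite ell2_inner_sumr (bigD1 i)//= linearZ/= !ell2_innerZl ell2_innerZr wT eqxx.
  rewrite big1 => [|j ji].
    by rewrite addr0 mul1r mulrA -normCK rmorphM/= rmorphXn.
  rewrite ell2_innerZl ell2_innerZr wT (_ : (_ == _) = false) ?mul0r ?mulr0//.
  by rewrite eq_sym; apply/negbTE.
have q0 : 0 < qform T x0.
  rewrite qx0 lt_neqAle sumr_ge0 => [|i _]; last by rewrite mulr_ge0 ?sqr_ge0 ?ltW.
  rewrite andbT; apply: contra c0 => /eqP/esym s0; apply/eqP/rowP => i.
  rewrite mxE; apply: eq0_normc; apply/eqP; rewrite -sqrf_eq0.
  have /psumr_eq0P/(_ i isT) : \sum_(i < k.+1) normc (c 0 i) ^+ 2 * g i = 0 by [].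
  move=> h; have /eqP := h (fun i _ => ltac:(by rewrite mulr_ge0 ?sqr_ge0 ?ltW)).
  by rewrite mulf_eq0 (gt_eqF (g0 _)) orbF.
have [l' [y [l'0 yU y1 Ty]]] := spectral_step M0 TM TS TC TU x0U q0.
exists (fun i => if i == k then y else u i), (fun i => if i == k then l' else l i).
have yu i : (i < k)%N -> ell2_inner y (u i) = 0 by move=> ik; apply: yU; exists i.
split=> [i j|i]; rewrite !ltnS.
  rewrite leq_eqVlt => /predU1P[->|ik]; rewrite leq_eqVlt => /predU1P[->|jk].
  - by rewrite !eqxx ell2_innerxx ell2_normrE y1 expr1n.
  - by rewrite eqxx (ltn_eqF jk) gtn_eqF// yu.
  - by rewrite eqxx (ltn_eqF ik) ell2_innerC yu// conjC0.
  - by rewrite (ltn_eqF ik) (ltn_eqF jk) uo.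
by rewrite leq_eqVlt => /predU1P[->|ik]; rewrite ?eqxx// (ltn_eqF ik); exact: ul.
Qed.

Lemma finite_set_pos_lbound (R : realType) (A : set R) :
  finite_set A -> (forall a, A a -> 0 < a) ->
  exists2 d, 0 < d & forall a, A a -> d <= a.
Proof.
move=> /finite_seqP[s ->]; elim: s => [|a s IH] As; first by exists 1.
have [d d0 ds] : exists2 d, 0 < d & forall a, [set` s] a -> d <= a.
  by apply: IH => b bs; apply: As; rewrite /= inE; apply/orP; right.
exists (Num.min a d); first by rewrite lt_min d0 andbT As//= inE eqxx.
move=> b /=; rewrite inE => /predU1P[->|/ds]; rewrite ge_min ?lexx//.
by move=> ->; rewrite orbT.
Qed.

(** If there were finitely many positive eigenvalues, they would all be at least
some [d > 0], and [k] orthonormal eigenvectors would give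
[k * d ^+ 2 <= D] for every [k], where [D] is the square Hilbert-Schmidt norm. *)
Lemma hs_op_infinite_positive (R : realType) (r : nat -> ell2 R)
    (rs : cvgn (series (fun n => rnorm (r n) ^+ 2)))
    (w : nat -> ell2 R) (g : nat -> R) :
  (forall n m, r n m = (r m n)^*) -> (forall i, 0 < g i) ->
  (forall i j, ell2_inner (hs_op rs (w i)) (w j) = (i == j)%:R * (g i)%:C) ->
  infinite_set [set l : R | 0 < l /\ eigenvalue_of (hs_op rs) l%:C].
Proof.
move=> rh g0 wT /finite_set_pos_lbound[|d d0 dA]; first by move=> a [].
have [M M0 TM] := hs_op_bound rs.
set D := limn (series (fun n => rnorm (r n) ^+ 2)).
have kD k : k%:R * d ^+ 2 <= D.
  have [u [l [uo ul]]] := positive_eigenvectors M0 TM (hs_op_self_adjoint rs rh)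
    (@hs_op_compact _ _ rs) g0 wT k.
  apply: le_trans (hs_op_sum_le rs uo).
  rewrite mulr_natl -[in leLHS](card_ord k) -sumr_const; apply: ler_sum => i _.
  have [li ei] := ul i (ltn_ord i).
  have ui : rnorm (u i) = 1.
    apply/eqP; rewrite -(@eqrXn2 _ 2) ?rnorm_ge0// expr1n; apply/eqP.
    apply: (@complexI R); rewrite rmorphXn/= -ell2_normrE -ell2_innerxx uo//.
    by rewrite eqxx.
  rewrite ei rnormZ ui mulr1 normcR gtr0_norm//.
  rewrite ler_pXn2r ?nnegrE ?(ltW d0) ?(ltW li)//.
  apply: dA; split=> //; exists (u i) => //.
  by rewrite -rnorm_eq0 ui oner_eq0.
have := kD (Num.bound `|D / d ^+ 2|); apply/negP; rewrite -ltNge.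
rewrite -ltr_pdivrMr ?exprn_gt0//.
apply: le_lt_trans (ler_norm _) _; apply: archi_boundP.
by rewrite normr_ge0.
Qed.

(** * Injectivity of gcd kernels *)

Lemma gcdn_coprimeMl a b m :
  coprime a b -> gcdn (a * b) m = (gcdn a m * gcdn b m)%N.
Proof.
move=> ab; apply/eqP; rewrite eqn_dvd; apply/andP; split.
  have dab := dvdn_gcdl (a * b) m; have dm := dvdn_gcdr (a * b) m.
  have dl x : (gcdn (a * b) m %| m * x)%N.
    by apply: dvdn_trans dm _; exact: dvdn_mulr.
  have dr x : (gcdn (a * b) m %| x * m)%N by rewrite (mulnC x m).
  by rewrite muln_gcdr !muln_gcdl !(dvdn_gcd (gcdn (a * b) m)) dab dl dr dl.
rewrite Gauss_dvd; last first.
  apply: coprime_dvdl (dvdn_gcdl a m) _; exact: coprime_dvdr (dvdn_gcdl b m) ab.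
rewrite !dvdn_gcd !dvdn_gcdr !andbT.
by rewrite dvdn_mulr ?dvdn_gcdl// dvdn_mull ?dvdn_gcdl.
Qed.

Lemma gcdn_primeX_ndvd p k m :
  prime p -> ~~ (p ^ k.+1 %| m)%N -> gcdn (p ^ k.+1) m = gcdn (p ^ k) m.
Proof.
move=> pp ndvd; apply/eqP; rewrite eqn_dvd !dvdn_gcd !dvdn_gcdr !andbT.
rewrite (dvdn_trans (dvdn_gcdl (p ^ k) m)) ?dvdn_exp2l// andbT.
have := dvdn_gcdl (p ^ k.+1) m; move=> /(dvdn_pfactor _ _ pp)[j jk E].
rewrite E dvdn_exp2l// -ltnS ltn_neqAle jk andbT.
by apply: contra ndvd => /eqP jE; rewrite -jE -E dvdn_gcdr.
Qed.

(** The terms of [y] are indexed from [0], those of [c] from [1]: divisibility is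
read on the indices of [c]. *)
Definition annihilates (R : realType) (y : nat -> R[i]) (c : nat -> R) : Prop :=
  series (fun k => (c k.+1)%:C * y k) @ \oo --> (0 : R[i]).

Lemma annihilates_ext (R : realType) (y : nat -> R[i]) (c d : nat -> R) :
  (forall m, (0 < m)%N -> c m = d m) -> annihilates y c -> annihilates y d.
Proof.
move=> cd; rewrite /annihilates.
rewrite (_ : (fun k => (d k.+1)%:C * y k) = (fun k => (c k.+1)%:C * y k))//.
by apply/funext => k; rewrite cd.
Qed.

Lemma annihilatesB (R : realType) (y : nat -> R[i]) (c d : nat -> R) :
  annihilates y c -> annihilates y d -> annihilates y (fun m => c m - d m).
Proof.
move=> yc yd.
pose u c n := series (fun k => ((c : nat -> R) k.+1)%:C * y k) n.
have uB : u (fun m => c m - d m) = u c - u d.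
  apply/funext => n; rewrite -[RHS]/(u c n - u d n) /u /series/= -sumrB.
  apply: eq_bigr => k _.
  by rewrite rmorphB/= mulrBl.
have : (u c - u d) @ \oo --> (0 - 0 : R[i]).
  exact: (@cvgB _ _ _ _ _ (u c) (u d) 0 0 yc yd).
by rewrite -uB subr0.
Qed.

Lemma annihilatesZ (R : realType) (y : nat -> R[i]) (a : R) (c : nat -> R) :
  annihilates y c -> annihilates y (fun m => a * c m).
Proof.
move=> yc.
pose u c n := series (fun k => ((c : nat -> R) k.+1)%:C * y k) n.
have uZ : u (fun m => a * c m) = (fun n => a%:C * u c n).
  apply/funext => n; rewrite /u /series/= mulr_sumr; apply: eq_bigr => k _.
  by rewrite rmorphM/= mulrA.
have : (fun n => a%:C * u c n) @ \oo --> (a%:C * 0 : R[i]).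
  exact: (@cvgMr _ _ _ _ _ _ _ yc).
by rewrite -uZ mulr0.
Qed.

(** Induction on [q], one prime power at a time. If [q = q' * p ^ k.+1] with [p]
prime to [q'] and to [n], then [h (gcdn (n * p ^ k.+1) m)] and
[h (gcdn (n * p ^ k) m)] differ only when [p ^ k.+1] divides [m], and then by
the nonzero factor [h (p ^ k.+1) - h (p ^ k)] times [h (gcdn n m)]. This
replaces the Moebius inversion that writes [h (gcdn n m)] as a sum over the
common divisors of [n] and [m]. *)
Lemma annihilates_dvd_gcd (R : realType) (h : nat -> R) (y : nat -> R[i]) :
  (forall m n, (0 < m)%N -> (0 < n)%N -> h (m * n)%N = h m * h n) ->
  (forall p k, prime p -> h (p ^ k.+1)%N != h (p ^ k)%N) ->
  (forall n, (0 < n)%N -> annihilates y (fun m => h (gcdn n m))) ->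
  forall q n, (0 < q)%N -> (0 < n)%N -> coprime q n ->
    annihilates y (fun m => (q %| m)%N%:R * h (gcdn n m)).
Proof.
move=> hM hX hy; elim/ltn_ind => q IH n q0 n0 qn.
have [q1|q1] := leqP q 1.
  have -> : q = 1%N by apply/eqP; rewrite eqn_leq q1.
  apply: annihilates_ext (hy n n0) => m _.
  by rewrite dvd1n mul1r.
have pp := pdiv_prime q1; set p := pdiv q in pp.
have [q' pq' qE] := pfactor_coprime pp q0.
have : (0 < logn p q)%N by rewrite logn_gt0 mem_primes pp q0 pdiv_dvd.
move: qE; case: (logn p q) => // k qE _.
have q'0 : (0 < q')%N by move: q0; rewrite qE muln_gt0 => /andP[].
have p0 : (0 < p)%N by exact: prime_gt0.
have pn : coprime p n.
  by apply: coprime_dvdl qn; rewrite pdiv_dvd.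
have q'n : coprime q' n by apply: coprime_dvdl qn; rewrite qE dvdn_mulr.
have q'q : (q' < q)%N.
  by rewrite qE ltn_Pmulr// -(expn0 p) ltn_exp2l// prime_gt1.
have H j : annihilates y (fun m => (q' %| m)%N%:R * h (gcdn (n * p ^ j) m)).
  apply: IH => //; first by rewrite muln_gt0 n0 expn_gt0 p0.
  by rewrite coprimeMr q'n coprimeXr// coprime_sym.
have := annihilatesZ (h (p ^ k.+1)%N - h (p ^ k)%N)^-1 (annihilatesB (H k.+1) (H k)).
apply: annihilates_ext => m m0.
have np j : coprime n (p ^ j) by rewrite coprimeXr// coprime_sym.
rewrite !gcdn_coprimeMl// !hM ?gcdn_gt0 ?n0 ?expn_gt0 ?p0//.
have q'p : coprime q' (p ^ k.+1) by rewrite coprimeXr// coprime_sym.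
rewrite qE (Gauss_dvd _ q'p).
case: (q' %| m)%N => /=; last by rewrite !mul0r subrr mulr0.
have [pm|pm] := boolP (p ^ k.+1 %| m)%N; last first.
  by rewrite gcdn_primeX_ndvd// subrr mulr0 mul0r.
have pm' : (p ^ k %| m)%N by apply: dvdn_trans pm; exact: dvdn_exp2l.
rewrite (gcdn_idPl pm) (gcdn_idPl pm').
rewrite !mul1r -mulrBr mulrC -mulrA mulfV ?mulr1//.
by rewrite subr_eq0 hX.
Qed.

(** Inclusion-exclusion, removing the multiples of one [q] at a time: the common
multiples of [d] and [q] are the multiples of their lcm. *)
Lemma annihilates_sieve (R : realType) (y : nat -> R[i]) :
  (forall d, (0 < d)%N -> annihilates y (fun m => (d %| m)%N%:R)) ->
  forall qs d, all (fun q => (0 < q)%N) qs -> (0 < d)%N ->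
    annihilates y (fun m => ((d %| m)%N && all (fun q => ~~ (q %| m)%N) qs)%:R).
Proof.
move=> hy; elim=> [|q qs IH] d /= qs0 d0.
  by apply: annihilates_ext (hy d d0) => m _; rewrite andbT.
case/andP: qs0 => q0 qs0.
have ld0 : (0 < lcmn d q)%N by rewrite lcmn_gt0 d0 q0.
apply: annihilates_ext (annihilatesB (IH d qs0 d0) (IH (lcmn d q) qs0 ld0)) => m _.
rewrite dvdn_lcm; case: (d %| m)%N => /=; last by rewrite subrr.
by case: (q %| m)%N => /=; rewrite ?subrr ?subr0.
Qed.

(** Sieving the multiples of [n.+1] by [2 n.+1, 3 n.+1, ..., (N + 1) n.+1] leaves
[n.+1] and numbers larger than [N], so that [y n] is bounded by a tail of the
absolutely convergent series. *)
Lemma annihilates_dvd_eq0 (R : realType) (y : nat -> R[i]) :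
  cvgn (series (fun k => normc (y k))) ->
  (forall d, (0 < d)%N -> annihilates y (fun m => (d %| m)%N%:R)) ->
  forall n, y n = 0.
Proof.
move=> cy hy n; apply: eq0_normc; apply/eqP; rewrite eq_le normc_ge0 andbT.
apply/ler_addgt0Pr => e e0; rewrite add0r.
have e2 : 0 < e / 2 by rewrite divr_gt0.
have [N0 hN0] := limn_tail_small cy e2.
(* N also exceeds n, so that the term of index n is in the partial sum *)
pose N := (maxn N0 n).+1.
have snd : nondecreasing_seq (series (fun k => normc (y k))).
  by apply: nondecreasing_series => k _ _; exact: normc_ge0.
have tail : limn (series (fun k => normc (y k))) -
    series (fun k => normc (y k)) N < e / 2.
  apply: le_lt_trans hN0; rewrite lerD2l lerN2; apply: snd.
  by rewrite /N; apply: leq_trans (leq_maxl _ _) _.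
pose qs := [seq (j.+2 * n.+1)%N | j <- iota 0 N].
pose b m : bool := (n.+1 %| m)%N && all (fun q => ~~ (q %| m)%N) qs.
have hb : annihilates y (fun m => (b m)%:R).
  apply: annihilates_sieve => //; apply/allP => _ /mapP[j _ ->].
  by rewrite muln_gt0.
have b_small k : (k < N)%N -> b k.+1 = (k == n).
  move=> kN; apply/idP/eqP => [/andP[/dvdnP[t kE] /allP ht]|->]; last first.
    rewrite /b dvdnn andTb; apply/allP => _ /mapP[j _ ->].
    by apply/negP => /dvdn_leq => /(_ isT); rewrite leqNgt ltn_Pmull.
  case: t kE ht => [//|[|t]] kE ht; first by move: kE; rewrite mul1n => -[].
  have tN : (t < N)%N.
    apply: leq_trans kN; rewrite kE; apply: (@leq_trans t.+2) => //.
    exact: leq_pmulr.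
  have : (t.+2 * n.+1)%N \in qs by apply/mapP; exists t; rewrite // mem_iota.
  by move=> /ht; rewrite kE dvdnn.
have /cvgrPdist_lt/(_ (e / 2)%:C) := hb; rewrite ltcR => /(_ e2)[K _ hK].
pose L := maxn K N.
have := hK L (leq_maxl _ _); rewrite /= sub0r normrN normc_normr ltcR => hL.
have NL : (N <= L)%N by exact: leq_maxr.
have sE : series (fun k => ((b k.+1)%:R : R)%:C * y k) L =
    y n + \sum_(N <= k < L) ((b k.+1)%:R : R)%:C * y k.
  rewrite /series/= (big_cat_nat (leq0n N) NL)/=; congr (_ + _).
  rewrite big_mkord.
  have nN : (n < N)%N by rewrite /N ltnS leq_maxr.
  rewrite (bigD1 (Ordinal nN))//= b_small// eqxx mul1r big1 ?addr0// => k kn.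
  by rewrite b_small// (_ : (_ == _) = false) ?mul0r//; apply/negbTE.
have -> : y n = series (fun k => ((b k.+1)%:R : R)%:C * y k) L -
    \sum_(N <= k < L) ((b k.+1)%:R : R)%:C * y k by rewrite sE addrK.
apply: le_trans (le_normcD _ _) _; rewrite normcN (splitr e).
apply: lerD; first exact: ltW.
apply: le_trans (ltW tail).
apply: (@le_trans _ _ (\sum_(N <= k < L) normc (y k))).
  rewrite -lecR -normc_normr rmorph_sum/=; apply: le_trans (ler_norm_sum _ _ _) _.
  apply: ler_sum => k _; rewrite normrM -[leRHS]mul1r ler_wpM2r//.
  by case: (b k.+1); rewrite ?normr1 ?normr0 ?ler01.
have := sub_series_geq (fun k => normc (y k)) NL => <-.
by rewrite lerD2r nondecreasing_cvgn_le.
Qed.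

Lemma gcd_kernel_injective (R : realType) (h : nat -> R) (y : nat -> R[i]) :
  h 1%N = 1 ->
  (forall m n, (0 < m)%N -> (0 < n)%N -> h (m * n)%N = h m * h n) ->
  (forall p k, prime p -> h (p ^ k.+1)%N != h (p ^ k)%N) ->
  cvgn (series (fun k => normc (y k))) ->
  (forall n, (0 < n)%N -> annihilates y (fun m => h (gcdn n m))) ->
  forall n, y n = 0.
Proof.
move=> h1 hM hX cy hy; apply: annihilates_dvd_eq0 => // d d0.
have := annihilates_dvd_gcd hM hX hy d0 (ltn0Sn 0) (coprimen1 d).
by apply: annihilates_ext => m _; rewrite gcd1n h1 mulr1.
Qed.

(** * Powers and the weights of the lcm matrix *)

Lemma powR_neg_lt (R : realType) (t a b : R) :
  t < 0 -> 0 < a -> a < b -> b `^ t < a `^ t.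
Proof.
move=> t0 a0 ab; have b0 : 0 < b by exact: lt_trans ab.
rewrite -(opprK t) !(powRN _ (- t)) ltf_pV2 ?posrE ?powR_gt0//.
by rewrite gt0_ltr_powR ?oppr_gt0 ?nnegrE ?ltW.
Qed.

Lemma powR_neg_le (R : realType) (t a b : R) :
  t < 0 -> 0 < a -> a <= b -> b `^ t <= a `^ t.
Proof.
move=> t0 a0; rewrite le_eqVlt => /predU1P[->//|ab].
by apply: ltW; exact: powR_neg_lt.
Qed.

(** Cauchy condensation: the values of [n.+1] from [2 ^ k] to [2 ^ k.+1 - 1]
contribute at most [q ^+ k], where [q = 2 `^ (t + 1)]. *)
Lemma cvg_pseries (R : realType) (t : R) : t < -1 ->
  cvgn (series (fun n => n.+1%:R `^ t)).
Proof.
move=> t1; have t0 : t < 0 by apply: lt_trans t1 _; rewrite oppr_lt0.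
have nd : nondecreasing_seq (series (fun n => n.+1%:R `^ t : R)).
  by apply: nondecreasing_series => n _ _; exact: powR_ge0.
pose q : R := 2 `^ (t + 1).
have q0 : 0 < q by rewrite powR_gt0.
have q1 : q < 1.
  have t10 : t + 1 < 0 by rewrite -ltrBrDr sub0r.
  by have := powR_neg_lt t10 ltr01 (ltr1n R 2); rewrite powR1.
have q10 : 0 < 1 - q by rewrite subr_gt0.
have dyadic k :
    series (fun n => n.+1%:R `^ t) (2 ^ k - 1)%N <= (1 - q ^+ k) / (1 - q).
  elim: k => [|k IH].
    by rewrite expn0 subnn /series/= big_nil expr0 subrr mul0r.
  have le2 : (2 ^ k - 1 <= 2 ^ k.+1 - 1)%N by rewrite leq_sub2r// leq_exp2l.
  rewrite /series/= (big_cat_nat (leq0n _) le2)/=.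
  rewrite (_ : (1 - q ^+ k.+1) / (1 - q) =
    (1 - q ^+ k) / (1 - q) + q ^+ k); last first.
    by rewrite exprS; field; rewrite gt_eqF.
  apply: lerD IH _.
  apply: (@le_trans _ _ (\sum_(2 ^ k - 1 <= n < 2 ^ k.+1 - 1) (2 ^ k)%N%:R `^ t)).
    rewrite !big_nat; apply: ler_sum => n /andP[n1 _].
    apply: powR_neg_le => //.
    by rewrite ler_nat -(@subnK 1 (2 ^ k)%N) ?expn_gt0// addn1 ltnS.
  rewrite sumr_const_nat (_ : (2 ^ k.+1 - 1 - (2 ^ k - 1) = 2 ^ k)%N); last first.
    by rewrite subnBA ?expn_gt0// subnK ?expn_gt0// expnS mul2n -addnn addnK.
  have E : (2 ^ k)%N%:R = 2 `^ k%:R :> R by rewrite powR_mulrn// natrX.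
  have -> : q ^+ k = 2 `^ (k%:R * t) * 2 `^ k%:R.
    rewrite -powRD; last by rewrite pnatr_eq0 implybT.
    by rewrite -powR_mulrn ?powR_ge0// /q -powRrM; congr (_ `^ _); ring.
  by rewrite -[leLHS]mulr_natr E powRrM.
apply: nondecreasing_is_cvgn => //; exists (1 - q)^-1 => _ [n _ <-].
apply: (@le_trans _ _ (series (fun n => n.+1%:R `^ t) (2 ^ n - 1)%N)).
  by apply: nd; rewrite -ltnS subn1 prednK ?expn_gt0// ltn_expl.
apply: le_trans (dyadic n) _; rewrite ler_pdivrMr// mulVf ?gt_eqF//.
by rewrite gerBl exprn_ge0// ltW.
Qed.

Lemma lcm_kernelE (R : realType) (sigma tau : R) (n m : nat) :
  (0 < n)%N -> (0 < m)%N ->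
  lcm_kernel sigma tau n m =
    n%:R `^ (sigma - tau) * m%:R `^ (sigma - tau) * (gcdn n m)%:R `^ tau.
Proof.
move=> n0 m0; rewrite /lcm_kernel.
have nn : n%:R != 0 :> R by rewrite pnatr_eq0 -lt0n.
have mn : m%:R != 0 :> R by rewrite pnatr_eq0 -lt0n.
rewrite !powRB ?nn ?mn ?implybT//.
have E : (lcmn n m)%:R `^ tau * (gcdn n m)%:R `^ tau =
    n%:R `^ tau * m%:R `^ tau :> R.
  by rewrite -!powRM// -!natrM muln_lcm_gcd.
have ln : (lcmn n m)%:R `^ tau != 0 :> R.
  by rewrite gt_eqF// powR_gt0// ltr0n lcmn_gt0 n0.
have tn : n%:R `^ tau != 0 :> R by rewrite gt_eqF// powR_gt0// ltr0n.
have tm : m%:R `^ tau != 0 :> R by rewrite gt_eqF// powR_gt0// ltr0n.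
have -> : (gcdn n m)%:R `^ tau =
    n%:R `^ tau * m%:R `^ tau / (lcmn n m)%:R `^ tau :> R.
  by rewrite -E mulrC mulKf.
by field; rewrite tn tm ln.
Qed.

(** * The lcm matrix and its test vectors *)

Lemma lcm_weight_cvg (R : realType) (sigma tau : R) : 1 / 2 < tau - sigma ->
  cvgn (series (fun n => (n.+1%:R `^ (sigma - tau) : R) ^+ 2)).
Proof.
move=> ts; rewrite (_ : (fun n => _) = (fun n => n.+1%:R `^ ((sigma - tau) * 2))).
  by apply: cvg_pseries; lra.
by apply/funext => n; rewrite powRrM powR_mulrn// powR_ge0.
Qed.

Lemma lcm_kernel_ge0 (R : realType) (sigma tau : R) n m :
  0 <= lcm_kernel sigma tau n m.
Proof. by rewrite /lcm_kernel divr_ge0 ?mulr_ge0 ?powR_ge0. Qed.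

Lemma lcm_kernelC (R : realType) (sigma tau : R) n m :
  lcm_kernel sigma tau n m = lcm_kernel sigma tau m n.
Proof. by rewrite /lcm_kernel lcmnC (mulrC (n%:R `^ sigma)). Qed.

Lemma lcm_kernel_le (R : realType) (sigma tau : R) n m : tau < 0 ->
  lcm_kernel sigma tau n.+1 m.+1 <=
    n.+1%:R `^ (sigma - tau) * m.+1%:R `^ (sigma - tau).
Proof.
move=> t0; rewrite lcm_kernelE// ler_piMr ?mulr_ge0 ?powR_ge0//.
have := @powR_neg_le R tau 1 (gcdn n.+1 m.+1)%:R t0 ltr01.
by rewrite powR1; apply; rewrite ler1n gcdn_gt0.
Qed.

Lemma lcm_row_le (R : realType) (sigma tau : R) n N :
  tau < 0 -> 1 / 2 < tau - sigma ->
  series (sqmod (lcm_matrix sigma tau n)) N <=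
    n.+1%:R `^ (sigma - tau) ^+ 2 *
      limn (series (fun m => (m.+1%:R `^ (sigma - tau) : R) ^+ 2)).
Proof.
move=> t0 ts; apply: (@le_trans _ _ (n.+1%:R `^ (sigma - tau) ^+ 2 *
  series (fun m => (m.+1%:R `^ (sigma - tau) : R) ^+ 2) N)).
  rewrite /series/= mulr_sumr; apply: ler_sum => m _.
  rewrite /sqmod normcR ger0_norm ?lcm_kernel_ge0// -exprMn.
  by rewrite ler_pXn2r ?nnegrE ?lcm_kernel_ge0 ?mulr_ge0 ?powR_ge0 ?lcm_kernel_le.
rewrite ler_wpM2l ?sqr_ge0// nondecreasing_cvgn_le//; last exact: lcm_weight_cvg.
by apply: nondecreasing_series => k _ _; exact: sqr_ge0.
Qed.

Lemma lcm_matrix_summable (R : realType) (sigma tau : R) :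
  tau < 0 -> 1 / 2 < tau - sigma ->
  forall n, lcm_matrix sigma tau n \in @square_summable R.
Proof.
by move=> t0 ts n; apply: square_summable_le (fun N => lcm_row_le n N t0 ts).
Qed.

Definition lcm_row (R : realType) (sigma tau : R) (t0 : tau < 0)
    (ts : 1 / 2 < tau - sigma) (n : nat) : ell2 R :=
  Ell2 (lcm_matrix_summable t0 ts n).

Lemma lcm_rowE (R : realType) (sigma tau : R) (t0 : tau < 0)
  (ts : 1 / 2 < tau - sigma) n m :
  lcm_row t0 ts n m = (lcm_kernel sigma tau n.+1 m.+1)%:C.
Proof. by []. Qed.

Lemma lcm_row_hs (R : realType) (sigma tau : R) (t0 : tau < 0)
    (ts : 1 / 2 < tau - sigma) :
  cvgn (series (fun n => rnorm (lcm_row t0 ts n) ^+ 2)).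
Proof.
have cw := lcm_weight_cvg ts.
apply: (@series_le_cvg _ _ (fun n =>
  limn (series (fun m => (m.+1%:R `^ (sigma - tau) : R) ^+ 2)) *
  (n.+1%:R `^ (sigma - tau)) ^+ 2)) => [n|n|n|].
- exact: sqr_ge0.
- rewrite mulr_ge0 ?sqr_ge0//.
  apply: le_trans (nondecreasing_cvgn_le _ cw 0%N).
    by rewrite /series/= big_nil.
  by apply: nondecreasing_series => k _ _; exact: sqr_ge0.
- rewrite rnorm_sqr mulrC.
  by have [] := bounded_sqmod (fun N => lcm_row_le n N t0 ts).
- exact: is_cvg_series_scale.
Qed.

Arguments lcm_row_hs {R sigma tau} t0 ts.

Lemma lcm_row_herm (R : realType) (sigma tau : R) (t0 : tau < 0)
  (ts : 1 / 2 < tau - sigma) n m :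
  lcm_row t0 ts n m = (lcm_row t0 ts m n)^*.
Proof.
by rewrite !lcm_rowE lcm_kernelC conj_Creal// ger0_real// lecR lcm_kernel_ge0.
Qed.

(** The weight cancels the factor [a%:R `^ (sigma - tau)] of the matrix, so that
the Gram matrix of these vectors is the matrix of powers of gcds. *)
Definition weighted_delta (R : realType) (sigma tau : R) (a : nat) : ell2 R :=
  (a%:R `^ (tau - sigma))%:C *: delta_ell2 R a.-1.

Lemma lcm_gram (R : realType) (sigma tau : R) (t0 : tau < 0)
  (ts : 1 / 2 < tau - sigma) a b : (0 < a)%N -> (0 < b)%N ->
  ell2_inner (hs_op (lcm_row_hs t0 ts) (weighted_delta sigma tau a))
    (weighted_delta sigma tau b) = ((gcdn a b)%:R `^ tau)%:C.
Proof.
move=> a0 b0; rewrite /weighted_delta linearZ/= ell2_innerZl ell2_innerZr.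
rewrite ell2_innerC ell2_inner_delta conjCK hs_opE ell2_inner_delta -lcm_row_herm.
rewrite lcm_rowE !prednK// lcm_kernelE// conj_Creal; last first.
  by rewrite ger0_real// lecR powR_ge0.
rewrite -!rmorphM/=; congr (_%:C).
rewrite -(opprB tau sigma) !(powRN _ (tau - sigma)).
have an : a%:R `^ (tau - sigma) != 0 :> R by rewrite gt_eqF// powR_gt0// ltr0n.
have bn : b%:R `^ (tau - sigma) != 0 :> R by rewrite gt_eqF// powR_gt0// ltr0n.
by field; rewrite an bn.
Qed.

(** For odd [p] these vectors are orthogonal for the quadratic form: the difference
between the values at [minn i.+1 j] and at [minn i j] of any function only
depends on whether [i < j], hence is the same for [j] and [j.+1] unless [i = j]. *)
Definition dyadic_test (R : realType) (sigma tau : R) (p i : nat) : ell2 R :=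
  weighted_delta sigma tau (p * 2 ^ i.+1) - weighted_delta sigma tau (p * 2 ^ i).

Lemma gcdn_odd_pow2 p p' i j : odd p -> odd p' ->
  gcdn (p * 2 ^ i) (p' * 2 ^ j) = (gcdn p p' * 2 ^ minn i j)%N.
Proof.
move=> op op'; rewrite gcdn_coprimeMl; last by rewrite coprimeXr// coprimen2.
rewrite Gauss_gcdl; last by rewrite coprimeXr// coprimen2.
by rewrite Gauss_gcdr ?expn_min// coprimeXl// coprime2n.
Qed.

Lemma dyadic_gram (R : realType) (sigma tau : R) (t0 : tau < 0)
  (ts : 1 / 2 < tau - sigma) p p' i j : odd p -> odd p' ->
  ell2_inner (hs_op (lcm_row_hs t0 ts) (dyadic_test sigma tau p i))
    (dyadic_test sigma tau p' j) =
  (i == j)%:R * ((gcdn p p')%:R `^ tau *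
    ((2 ^ i.+1)%N%:R `^ tau - (2 ^ i)%N%:R `^ tau))%:C.
Proof.
move=> op op'.
have p0 k : (0 < p * 2 ^ k)%N by rewrite muln_gt0 odd_gt0// expn_gt0.
have p'0 k : (0 < p' * 2 ^ k)%N by rewrite muln_gt0 odd_gt0// expn_gt0.
rewrite /dyadic_test linearB/= ell2_innerBl !ell2_innerBr !lcm_gram//.
rewrite !gcdn_odd_pow2// !natrM !powRM//.
have [->|ij] := eqVneq i j.
  rewrite mul1r !minnn (minn_idPr (leqnSn j)) (minn_idPl (leqnSn j)).
  by rewrite -!rmorphB/=; congr (_%:C); ring.
rewrite mul0r; move: ij; rewrite neq_ltn => /orP[ij|ij].
  rewrite (minn_idPl (_ : i.+1 <= j.+1)%N) ?ltnS 1?ltnW// (minn_idPl ij).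
  rewrite (minn_idPl (leqW (ltnW ij))) (minn_idPl (ltnW ij)).
  by rewrite -!rmorphB/= !subrr.
rewrite (minn_idPr (_ : j.+1 <= i.+1)%N) ?ltnS 1?ltnW// (minn_idPr ij).
rewrite (minn_idPr (leqW (ltnW ij))) (minn_idPr (ltnW ij)).
by rewrite subrr.
Qed.

(** * Negative eigenvalues and the kernel *)

Lemma hs_rows_opp (R : realType) (r : nat -> ell2 R) :
  cvgn (series (fun n => rnorm (r n) ^+ 2)) ->
  cvgn (series (fun n => rnorm (- r n) ^+ 2)).
Proof. by under [X in _ -> cvgn (series X)]eq_fun do rewrite rnormN. Qed.

Lemma hs_op_opp (R : realType) (r : nat -> ell2 R)
    (rs : cvgn (series (fun n => rnorm (r n) ^+ 2)))
    (rs' : cvgn (series (fun n => rnorm (- r n) ^+ 2))) (x : ell2 R) :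
  hs_op rs' x = - hs_op rs x.
Proof.
apply: ell2_ext => n; rewrite hs_opE ell2_innerNr.
by rewrite -[RHS]/(- (hs_op rs x n)) hs_opE.
Qed.

Lemma hs_op_infinite_negative (R : realType) (r : nat -> ell2 R)
    (rs : cvgn (series (fun n => rnorm (r n) ^+ 2)))
    (w : nat -> ell2 R) (g : nat -> R) :
  (forall n m, r n m = (r m n)^*) -> (forall i, g i < 0) ->
  (forall i j, ell2_inner (hs_op rs (w i)) (w j) = (i == j)%:R * (g i)%:C) ->
  infinite_set [set l : R | l < 0 /\ eigenvalue_of (hs_op rs) l%:C].
Proof.
move=> rh g0 wT fin.
(* the negative eigenvalues are the opposites of the positive ones of the
   operator with rows - r n *)
have rs' := hs_rows_opp rs.
apply: (@hs_op_infinite_positive R (fun n => - r n) rs' w (fun i => - g i)).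
- move=> n m; rewrite -[LHS]/(- (r n m)) -[X in X^*]/(- (r m n)).
  by rewrite rmorphN/= -rh.
- by move=> i; rewrite oppr_gt0.
- move=> i j; rewrite hs_op_opp ell2_innerNl wT rmorphN/=.
  by rewrite mulrN.
apply: sub_finite_set (finite_image (-%R) fin) => l /= [l0 [x x0 Tx]].
exists (- l); last by rewrite opprK.
split; first by rewrite oppr_lt0.
exists x => //; move: Tx; rewrite hs_op_opp rmorphN/= scaleNr => /eqP.
by rewrite eqr_oppLR => /eqP.
Qed.

Lemma natpowM (R : realType) (tau : R) (m n : nat) :
  ((m * n)%N%:R : R) `^ tau = m%:R `^ tau * n%:R `^ tau.
Proof. by rewrite natrM powRM. Qed.

Lemma natpow_prime_lt (R : realType) (tau : R) p k : tau < 0 -> (1 < p)%N ->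
  (p ^ k.+1)%N%:R `^ tau < (p ^ k)%N%:R `^ tau :> R.
Proof.
move=> t0 p1; apply: powR_neg_lt => //; first by rewrite ltr0n expn_gt0 ltnW.
by rewrite ltr_nat ltn_exp2l.
Qed.

Lemma lcm_op_injective (R : realType) (sigma tau : R) (t0 : tau < 0)
    (ts : 1 / 2 < tau - sigma) (x : ell2 R) :
  hs_op (lcm_row_hs t0 ts) x = 0 -> x = 0.
Proof.
move=> Tx; pose wt k : R := k.+1%:R `^ (sigma - tau).
have wt0 k : 0 < wt k by rewrite powR_gt0// ltr0n.
pose y k := (wt k)%:C * x k.
suff y0 : forall k, y k = 0.
  apply: ell2_ext => k; have /eqP := y0 k; rewrite mulf_eq0 => /predU1P[|/eqP//].
  by move=> /(@complexI R) w0; have := wt0 k; rewrite w0 ltxx.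
apply: (@gcd_kernel_injective _ (fun n => n%:R `^ tau)).
- by rewrite powR1.
- by move=> m n _ _; exact: natpowM.
- by move=> p k pp; rewrite lt_eqF// natpow_prime_lt// prime_gt1.
- apply: (@series_le_cvg _ _ ((fun k => wt k ^+ 2) + sqmod x)) => [k|k|k|].
  + exact: normc_ge0.
  + by rewrite fctE addr_ge0 ?sqr_ge0 ?sqmod_ge0.
  + rewrite normcM normcR (gtr0_norm (wt0 k)) fctE /sqmod.
    have := sqr_ge0 (wt k - normc (x k)); have := normc_ge0 (x k).
    have := wt0 k; move: (wt k) (normc (x k)); clear => a b; nra.
  + by apply: is_cvg_seriesD; [exact: lcm_weight_cvg|exact: ell2_cvg].
case=> // n _.
have an : annihilates y (fun m => wt n * (gcdn n.+1 m)%:R `^ tau).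
  have := @hs_op_matrix _ _ (lcm_row_hs t0 ts) x n; rewrite Tx.
  rewrite (_ : (fun m => (lcm_row t0 ts n m)^* * x m) =
    (fun k => (wt n * (gcdn n.+1 k.+1)%:R `^ tau)%:C * y k)) //.
  apply/funext => m; rewrite -lcm_row_herm lcm_rowE lcm_kernelC lcm_kernelE//.
  by rewrite /y mulrA -rmorphM/=; congr (_%:C * _); rewrite /wt gcdnC; ring.
have := annihilatesZ (wt n)^-1 an; apply: annihilates_ext => m _.
by rewrite mulKf// gt_eqF.
Qed.

(** * The spectrum of the lcm matrix *)

Unset Implicit Arguments.

Theorem theorem1p2 (R : realType) (sigma tau : R)
    (tau_lt0 : tau < 0) (tau_sigma : 1 / 2 < tau - sigma) :
  exists T : {linear ell2 R -> ell2 R},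
    [/\ matrix_operator (lcm_matrix sigma tau) T,
        bounded_operator T,
        compact_operator T,
        self_adjoint T &
        T @^-1` [set 0] = [set 0]] /\
    infinite_set [set l : R | l < 0 /\ eigenvalue_of T l%:C] /\
    infinite_set [set l : R | 0 < l /\ eigenvalue_of T l%:C].
Proof.
have ts := tau_sigma.
pose rs := lcm_row_hs tau_lt0 ts.
have rh := @lcm_row_herm R sigma tau tau_lt0 ts.
have dpos i : (2 ^ i.+1)%N%:R `^ tau - (2 ^ i)%N%:R `^ tau < 0 :> R.
  by rewrite subr_lt0 natpow_prime_lt.
exists (hs_op rs); split; [split|split].
- move=> x n; have := @hs_op_matrix _ _ rs x n.
  rewrite (_ : (fun m => (lcm_row tau_lt0 ts n m)^* * x m) =
    (fun m => lcm_matrix sigma tau n m * x m))//.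
  by apply/funext => m; rewrite -rh lcm_rowE lcm_kernelC.
- by have [M _ TM] := hs_op_bound rs; exact: bounded_operator_rnorm TM.
- exact: hs_op_compact.
- exact: hs_op_self_adjoint.
- apply/seteqP; split=> x /=; first exact: lcm_op_injective.
  by move=> ->; rewrite linear0.
(* the form takes the value (2^(i+1))^tau - (2^i)^tau < 0 at the i-th vector *)
- apply: (@hs_op_infinite_negative _ _ rs (dyadic_test sigma tau 1) _ rh dpos).
  by move=> i j; rewrite dyadic_gram// gcd1n powR1 mul1r.
(* a second prime reverses the sign: it multiplies the previous values by
   the negative number 3^tau - 1 *)
pose h3 : R := 3%:R `^ tau.
have h31 : h3 < 1.
  by have := @powR_neg_lt R tau 1 3 tau_lt0 ltr01; rewrite powR1 ltr1n; apply.
apply: (@hs_op_infinite_positive _ _ rs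
  (fun i => dyadic_test sigma tau 3 i - dyadic_test sigma tau 1 i)
  (fun i => (h3 - 1) * ((2 ^ i.+1)%N%:R `^ tau - (2 ^ i)%N%:R `^ tau))) => //.
  by move=> i; rewrite nmulr_rgt0 ?dpos// subr_lt0.
move=> i j; rewrite linearB/= ell2_innerBl.
rewrite !(ell2_innerBr (dyadic_test sigma tau 3 j) (dyadic_test sigma tau 1 j)).
rewrite !dyadic_gram//.
rewrite gcdnn gcdn1 !gcd1n powR1 !mul1r -/h3 -!mulrBr -!rmorphB/=.
by congr (_ * _%:C); ring.
Qed.
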